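(* Let $1\le k\le n$ and $t=n+1-k$. Then there is a homotopy equivalence $$U([n],k)\;\simeq\;\bigvee_{i=1}^{t}\ \bigvee_{\binom{t}{i}} S^{2n-1-i},$$ i.e. $U([n],k)$ is homotopy equivalent to a wedge containing, for each $i=1,\dots,t$, exactly $\binom{t}{i}$ copies of $S^{2n-1-i}$.
   Context: Let $S^{2n}=\{(z_1,\dots,z_n,x)\in\mathbb{C}^n\times\mathbb{R}:|z_1|^2+\cdots+|z_n|^2+x^2=1\}$ with orbit map (for the coordinatewise $T^n$-action on the $z_i$) $\pi(z_1,\dots,z_n,x)=(|z_1|,\dots,|z_n|,x)$ onto $Q^n=\{(x_1,\dots,x_n,x)\in\mathbb{R}^{n+1}:x_1^2+\cdots+x_n^2+x^2=1,\ x_i\ge0\}$. The manifold with corners $Q^n$ has as faces: $Q^n$ itself, the sets obtained by setting some of $x_1,\dots,x_n$ (fewer than $n$ of them) equal to $0$, and the two vertices $(0,\dots,0,\pm1)$. Its edges are $E_i=\{(0,\dots,0,x_i,0,\dots,0,x)\in Q^n\}$, $i=1,\dots,n$. For $1\le k\le n$, $V([n],k)$ is the union of all faces of $Q^n$ that do not contain all of the edges $E_k,\dots,E_n$, and $U([n],k)=\pi^{-1}(V([n],k))\subset S^{2n}$. *)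

(* Defs.v *)
From HB Require Import structures.
From mathcomp Require Import all_boot all_order all_algebra complex.
From mathcomp Require Import all_classical all_reals all_analysis homotopy.

Set Implicit Arguments.
Unset Strict Implicit.
Unset Printing Implicit Defensive.

Import Order.TTheory GRing.Theory Num.Theory.
Import numFieldNormedType.Exports.
Local Open Scope classical_set_scope.
Local Open Scope ring_scope.
Local Open Scope complex_scope.

(* Note that [X * R] carries the product topology, and that continuity on the
   subset X x [0, 1] is continuity of the restriction. *)
Definition homotopic (R : realType) (X Y : topologicalType) (f g : X -> Y) :=
  exists H : X * R -> Y,
    [/\ {within [set: X] `*` `[0, 1], continuous H},
        forall x, H (x, 0) = f x & forall x, H (x, 1) = g x].

Definition homotopy_equivalent (R : realType) (X Y : topologicalType) :=
  exists (f : X -> Y) (g : Y -> X),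
    [/\ continuous f, continuous g,
        homotopic R (g \o f) id & homotopic R (f \o g) id].

Definition unit_sphere (R : realType) (m : nat) : set 'rV[R]_m.+1 :=
  [set v | \sum_(i < m.+1) v 0 i ^+ 2 = 1].
Arguments unit_sphere : clear implicits.

Lemma unit_sphere_base_subproof (R : realType) (m : nat) :
  (delta_mx 0 0 : 'rV[R]_m.+1) \in unit_sphere R m.
Proof.
rewrite inE /unit_sphere /= (bigD1 ord0) //= mxE !eqxx /= expr1n big1 ?addr0 //.
by move=> i /negbTE i0; rewrite mxE i0 andbF expr0n.
Qed.

Definition unit_sphere_base (R : realType) (m : nat) :
    set_type (unit_sphere R m) :=
  exist _ (delta_mx 0 0) (unit_sphere_base_subproof R m).

Definition sphere_wedge (R : realType) (I : choiceType) (d : I -> nat)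
    : topologicalType :=
  wedge (X := fun i => set_type (unit_sphere R (d i)))
        (fun i => unit_sphere_base R (d i)).

Section Orbit.
Variables (R : realType) (n : nat).

(* [^o] selects the topology that R[i] has as a numFieldType. *)
Definition even_sphere : set ('rV[R[i]^o]_n * R) :=
  [set p : 'rV[R[i]^o]_n * R |
    \sum_(i < n) Normc.normc (p.1 0 i) ^+ 2 + p.2 ^+ 2 = 1].

Definition orbit_map (p : 'rV[R[i]^o]_n * R) : 'rV[R]_n * R :=
  (\row_(i < n) Normc.normc (p.1 0 i), p.2).

Definition orbit_space : set ('rV[R]_n * R) :=
  [set q : 'rV[R]_n * R |
    \sum_(i < n) q.1 0 i ^+ 2 + q.2 ^+ 2 = 1 /\ forall i, 0 <= q.1 0 i].

Definition coord_face (A : {set 'I_n}) : set ('rV[R]_n * R) :=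
  orbit_space `&` [set q : 'rV[R]_n * R | forall i, i \in A -> q.1 0 i = 0].

(* The case of the empty set A is the face Q^n itself. *)
Definition is_face (F : set ('rV[R]_n * R)) : Prop :=
  [\/ exists2 A : {set 'I_n}, (#|A| < n)%N & F = coord_face A,
      F = [set (0, 1)] | F = [set (0, -1)]].

Definition edge (i : 'I_n) : set ('rV[R]_n * R) :=
  orbit_space `&` [set q : 'rV[R]_n * R | forall j, j != i -> q.1 0 j = 0].

(* The ordinal i : 'I_n stands for the index i.+1 of {1, ..., n}. *)
Definition V_set (k : nat) : set ('rV[R]_n * R) :=
  \bigcup_(F in [set F | is_face F
                  /\ ~ forall i : 'I_n, (k <= i.+1)%N -> edge i `<=` F]) F.

Definition U_set (k : nat) : set ('rV[R[i]^o]_n * R) :=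
  even_sphere `&` orbit_map @^-1` V_set k.

End Orbit.

Arguments U_set : clear implicits.
Arguments sphere_wedge : clear implicits.

(* Main.v *)
(**
  U([n],k) is the part of the unit sphere of C^n x R where the product of the
  t coordinates z_k, ..., z_n vanishes. Up to radial retraction it may be
  replaced by a cone minus the origin, and more generally one can look at the
  cone K of the points of a real coordinate space at which one of l disjoint
  pairs of coordinates vanishes.

  Single out one pair (a, b), and let K' be the cone of the points of
  {a = b = 0} at which one of the other pairs vanishes. Then K is the union of
  the linear space L = {a = b = 0} and of the product K' x R^2, and these two
  pieces meet in K'. Away from the origin both inclusions K' -> L and
  K' -> K' x R^2 are null-homotopic relative to the base point, by bending
  straight lines in a direction u of L which avoids K' and in a direction r of
  R^2 respectively. Hence, minus the origin,
      K ~ L v (K' x R) v (K' x R^2),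
  where K' x R plays the role of the suspension of K'. The last two cones are
  again of the same kind with one pair less, so the sphere dimensions obey a
  recursion which is solved by Pascal's rule.
*)
Require Import Defs.
From mathcomp Require Import all_boot all_order all_algebra complex.
From mathcomp Require Import all_classical all_reals all_analysis homotopy.
From mathcomp Require Import ring lra zify.

Set Implicit Arguments.
Unset Strict Implicit.
Unset Printing Implicit Defensive.

Import Order.TTheory GRing.Theory Num.Theory.
Import numFieldNormedType.Exports.
Local Open Scope classical_set_scope.
Local Open Scope ring_scope.

(** * Continuity on subsets *)

(** A straight segment from a nonzero point x to the base point [e] meets the origin only if x is a
    negative multiple of [e]; this is what obstructs contracting K' in either piece, and the bend
    removes it. The base point is the unit vector of the real coordinate, which belongs to no pair,
    so adding multiples of it never leaves K'. As u serves the vector with all coordinates 1 in L: a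
    point of K' has a vanishing coordinate belonging to a pair, and adding s u turns that coordinate
    into s. That a union splits once its intersection contracts in both pieces is not taken from a
    general theory of homotopy pushouts: both maps of the equivalence and all homotopies are
    explicit formulas on the ambient space, and most of the work is to check that they avoid 0. *)

Lemma within_continuousP (S W : topologicalType) (D : set S) (f : S -> W) :
  {within D, continuous f} <->
  forall x, D x -> forall U, nbhs (f x) U -> nbhs x [set y | D y -> U (f y)].
Proof. by split=> [/subspace_continuousP|H]; last exact/subspace_continuousP. Qed.

Section Paste.
Variables (R : realType) (S W : topologicalType).

(** Where [T x] lies strictly on one side of [c], so do all nearby points, and the condition on the
    other formula is vacuous there. *)
Lemma within_paste (D : set S) (T : S -> R) (c : R) (f g : S -> W) :
  {within D, continuous T} ->
  {within D `&` [set x | T x <= c], continuous f} ->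
  {within D `&` [set x | c <= T x], continuous g} ->
  (forall x, D x -> T x = c -> f x = g x) ->
  {within D, continuous (fun x => if T x <= c then f x else g x)}.
Proof.
move=> /within_continuousP cT /within_continuousP cf.
move=> /within_continuousP cg fg; apply/within_continuousP => x Dx.
pose h x := if T x <= c then f x else g x; rewrite -/(h x).
have hg y : D y -> c <= T y -> h y = g y.
  move=> Dy cy; rewrite /h; case: leP => // yc; apply: fg => //.
  by apply/eqP; rewrite eq_le yc.
have hf y : T y <= c -> h y = f y by rewrite /h => ->.
move=> U hU.
have Uf : nbhs x [set y | D y -> T y <= c -> U (f y)].
  have [xc|cx] := leP (T x) c.
    rewrite hf // in hU; apply: filterS (cf x (conj Dx xc) U hU) => y yU Dy yc.
    exact: yU.
  apply: filterS (cT x Dx _ (lt_nbhsr cx)) => y /= yU Dy yc.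
  by have := yU Dy; rewrite ltNge yc.
have Ug : nbhs x [set y | D y -> c <= T y -> U (g y)].
  have [cx|xc] := leP c (T x).
    rewrite hg // in hU; apply: filterS (cg x (conj Dx cx) U hU) => y yU Dy yc.
    exact: yU.
  apply: filterS (cT x Dx _ (lt_nbhsl xc)) => y /= yU Dy yc.
  by have := yU Dy; rewrite ltNge yc.
apply: filterS2 Uf Ug => y /= yf yg Dy.
by rewrite -/(h y) /h; case: leP => // yc; [exact: yf|apply: yg => //; exact: ltW].
Qed.

Lemma within_paste3 (D : set S) (T : S -> R) (c d : R) (f g h : S -> W) :
  c < d ->
  {within D, continuous T} ->
  {within D `&` [set x | T x <= c], continuous f} ->
  {within D `&` [set x | c <= T x <= d], continuous g} ->
  {within D `&` [set x | d <= T x], continuous h} ->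
  (forall x, D x -> T x = c -> f x = g x) ->
  (forall x, D x -> T x = d -> g x = h x) ->
  {within D, continuous
     (fun x => if T x <= c then f x else if T x <= d then g x else h x)}.
Proof.
move=> cd cT cf cg ch fg gh; apply: within_paste => //; last first.
  by move=> x Dx Tx; rewrite Tx (ltW cd) fg.
apply: within_paste => //.
- by apply: continuous_subspaceW cT => x [].
- by apply: continuous_subspaceW cg => x [[Dx /= ->] ->].
- by apply: continuous_subspaceW ch => x [[Dx /= _] ?].
- by move=> x [Dx _]; exact: gh.
Qed.

End Paste.

Section SetType.
Variables (S : topologicalType) (A : set S).

Definition set_pt (v : S) (Av : A v) : set_type A := exist _ v (mem_set Av).

(** [a] is a mere default outside [A]. Maps into a subset can thus be given by ambient formulas,
    with membership checked afterwards. *)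
Definition clip (a : set_type A) (v : S) : set_type A := insubd a v.

Lemma val_clip a v : A v -> set_val (clip a v) = v.
Proof. by move=> /mem_set Av; rewrite set_valE /clip insubdK. Qed.

Lemma clipK a (x : set_type A) : clip a (set_val x) = x.
Proof. by apply: val_inj; rewrite -!set_valE val_clip //; exact: set_valP. Qed.

Lemma continuous_val : continuous (set_val : set_type A -> S).
Proof. exact: initial_continuous. Qed.

Lemma continuous_clip (U : topologicalType) (B : set U) (a : set_type A)
    (phi : U -> S) :
  {within B, continuous phi} -> (forall x, B x -> A (phi x)) ->
  {within B, continuous (fun x => clip a (phi x))}.
Proof.
move=> /within_continuousP cphi BA; apply/within_continuousP => x Bx.
move=> U' [_ /= [[W oW <-]] Wx WU].
have Wphi : nbhs (phi x) W.
  by apply: open_nbhs_nbhs; split => //; rewrite -(@val_clip a (phi x)) //; exact: BA.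
apply: filterS (cphi x Bx W Wphi) => y /= yW By; apply: WU => /=.
by rewrite val_clip; [exact: yW|exact: BA].
Qed.

Lemma hausdorff_set_type : hausdorff_space S -> hausdorff_space (set_type A).
Proof.
move=> hS x y xy; apply: val_inj; rewrite -!set_valE; apply: hS => U V Ux Vy.
have [z [Uz Vz]] := xy _ _ (continuous_val Ux) (continuous_val Vy).
by exists (set_val z).
Qed.

End SetType.

Lemma continuous_compW (S U W : topologicalType) (D : set U) (h : S -> U)
    (phi : U -> W) :
  {within D, continuous phi} -> (forall x, D (h x)) -> continuous h ->
  continuous (phi \o h).
Proof.
move=> /within_continuousP cphi hD ch x V /= Vx.
have : nbhs x (h @^-1` [set y | D y -> V (phi y)]).
  by apply: ch; exact: cphi (hD x) _ Vx.
by apply: filterS => y; apply; exact: hD.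
Qed.

Section Continuity.
Variables (R : realType) (T : topologicalType).
Implicit Types (V : normedModType R) (f g : T -> R) (x : T).

Lemma cont_max f g x : continuous_at x f -> continuous_at x g ->
  continuous_at x (fun y => Num.max (f y) (g y)).
Proof. exact: continuous_max. Qed.

Lemma cont_min f g x : continuous_at x f -> continuous_at x g ->
  continuous_at x (fun y => Num.min (f y) (g y)).
Proof. exact: continuous_min. Qed.

Lemma cont_add V (f g : T -> V) x :
  continuous_at x f -> continuous_at x g ->
  continuous_at x (fun y => f y + g y).
Proof. exact: cvgD. Qed.

Lemma cont_opp V (f : T -> V) x :
  continuous_at x f -> continuous_at x (fun y => - f y).
Proof. exact: cvgN. Qed.

Lemma cont_mul f g x : continuous_at x f -> continuous_at x g ->
  continuous_at x (fun y => f y * g y).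
Proof. exact: cvgM. Qed.

Lemma cont_scale V f (g : T -> V) x :
  continuous_at x f -> continuous_at x g ->
  continuous_at x (fun y => f y *: g y).
Proof. exact: cvgZ. Qed.

Lemma cont_inv f x : f x != 0 -> continuous_at x f ->
  continuous_at x (fun y => (f y)^-1).
Proof. exact: cvgV. Qed.

Lemma cont_norm V (f : T -> V) x :
  continuous_at x f -> continuous_at x (fun y => `|f y|).
Proof. exact: cvg_norm. Qed.

Lemma cont_comp (U W : topologicalType) (h : U -> W) (f : T -> U) x :
  continuous h -> continuous_at x f -> continuous_at x (fun y => h (f y)).
Proof. by move=> ch cf; apply: continuous_comp cf _; exact: ch. Qed.

Lemma cont_fst (U W : topologicalType) (f : T -> U * W) x :
  continuous_at x f -> continuous_at x (fun y => (f y).1).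
Proof. by move=> cf; apply: cont_comp cf => y; exact: cvg_fst. Qed.

Lemma cont_snd (U W : topologicalType) (f : T -> U * W) x :
  continuous_at x f -> continuous_at x (fun y => (f y).2).
Proof. by move=> cf; apply: cont_comp cf => y; exact: cvg_snd. Qed.

Lemma cont_pair (U W : topologicalType) (f : T -> U) (g : T -> W) x :
  continuous_at x f -> continuous_at x g ->
  continuous_at x (fun y => (f y, g y)).
Proof. by move=> cf cg; exact: cvg_pair. Qed.

Lemma cont_id x : continuous_at x (fun y => y).
Proof. exact: cvg_id. Qed.

Lemma cont_cst (U : topologicalType) (c : U) x :
  continuous_at x (fun=> c).
Proof. exact: cvg_cst. Qed.

End Continuity.

Lemma within_comp (S U W : topologicalType) (D : set S) (D' : set U)
    (h : S -> U) (phi : U -> W) :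
  {within D', continuous phi} -> (forall x, D x -> D' (h x)) ->
  (forall x, D x -> continuous_at x h) ->
  {within D, continuous (fun x => phi (h x))}.
Proof.
move=> /within_continuousP cphi hD ch; apply/within_continuousP => x Dx U' Ux.
have hU : nbhs x (h @^-1` [set y | D' y -> U' (phi y)]).
  by apply: ch => //; exact: cphi (hD x Dx) _ Ux.
by apply: filterS hU => y /= + Dy; apply; exact: hD.
Qed.

Lemma within_continuous_at (S W : topologicalType) (D : set S) (f : S -> W) :
  (forall x, D x -> continuous_at x f) -> {within D, continuous f}.
Proof.
move=> cf; apply/within_continuousP => x Dx U Ux.
have fU : nbhs x (f @^-1` U) by exact: cf.
by apply: filterS fU => y fy _; exact: fy.
Qed.

Section Clamp.
Variable R : realType.

Definition clamp01 (t : R) : R := Num.max 0 (Num.min 1 t).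

Lemma clamp01_itv t : (0 <= clamp01 t <= 1).
Proof. by rewrite /clamp01 le_max lexx /= ge_max ler01 ge_min lexx. Qed.

Lemma clamp01_id t : 0 <= t <= 1 -> clamp01 t = t.
Proof. by move=> /andP[t0 t1]; rewrite /clamp01 min_r // max_r. Qed.

Lemma clamp01_continuous : continuous clamp01.
Proof.
by move=> t; apply: cont_max; [exact: cont_cst|apply: cont_min; [exact: cont_cst|exact: cont_id]].
Qed.

End Clamp.

Ltac contauto := unfold prop_for; repeat
  lazymatch goal with
  | H : continuous_at ?x ?h |- continuous_at ?x ?h => exact H
  | |- continuous_at ?x (fun y => y) => apply cont_id
  | |- continuous_at ?x (fun y => @?f y + @?g y) => apply (@cont_add _ _ _ f g x)
  | |- continuous_at ?x (fun y => - @?f y) => apply (@cont_opp _ _ _ f x)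
  | |- continuous_at ?x (fun y => @?f y * @?g y) => apply (@cont_mul _ _ f g x)
  | |- continuous_at ?x (fun y => @?f y *: @?g y) => apply (@cont_scale _ _ _ f g x)
  | |- continuous_at ?x (fun y => `|@?f y|) => apply (@cont_norm _ _ _ f x)
  | |- continuous_at ?x (fun y => Num.max (@?f y) (@?g y)) => apply (@cont_max _ _ f g x)
  | |- continuous_at ?x (fun y => Num.min (@?f y) (@?g y)) => apply (@cont_min _ _ f g x)
  | |- continuous_at ?x (fun y => (@?f y).1) => apply (@cont_fst _ _ _ f x)
  | |- continuous_at ?x (fun y => (@?f y).2) => apply (@cont_snd _ _ _ f x)
  | |- continuous_at ?x (fun y => (@?f y, @?g y)) => apply (@cont_pair _ _ _ f g x)
  | |- continuous_at ?x (fun y => clamp01 (@?f y)) =>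
      apply (@cont_comp _ _ _ _ f x (@clamp01_continuous _))
  | |- continuous_at ?x (fun y => set_val (@?f y)) =>
      apply (@cont_comp _ _ _ _ f x (@continuous_val _ _))
  | H : continuous ?h |- continuous_at ?x (fun y => ?h (@?f y)) =>
      apply (@cont_comp _ _ _ h f x H)
  | H : continuous ?h |- continuous_at ?x ?h => exact (H x)
  | |- continuous_at _ _ => solve [apply cont_cst]
  end.

(** * Pointed homotopy equivalences and wedges *)

Section PtdHomotopy.
Variable R : realType.
Implicit Types X Y Z : topologicalType.

(** Time ranges over the whole line, so that continuity is not relative to a subset; formulas valid
    on [0, 1] only are extended by [clamp01]. *)
Definition ptd_homotopic X Y (x0 : X) (f g : X -> Y) :=
  exists H : R -> X -> Y,
    [/\ continuous (fun p : R * X => H p.1 p.2), H 0 =1 f, H 1 =1 g &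
        forall t, H t x0 = f x0].

Lemma ptd_homotopic_refl X Y (x0 : X) (f : X -> Y) :
  continuous f -> ptd_homotopic x0 f f.
Proof.
by move=> cf; exists (fun=> f); split => // p; contauto.
Qed.

Lemma ptd_homotopic_trans X Y (x0 : X) (f g h : X -> Y) :
  ptd_homotopic x0 f g -> ptd_homotopic x0 g h -> ptd_homotopic x0 f h.
Proof.
move=> [H [cH H0 H1 Hx]] [K [cK K0 K1 Kx]].
exists (fun t x => if 2 * t <= 1 then H (clamp01 (2 * t)) x
                   else K (clamp01 (2 * t - 1)) x).
split => [|x|x|t].
- apply/continuous_subspace_setT.
  apply: (within_paste (T := fun p : R * X => 2 * p.1)
    (f := fun p => H (clamp01 (2 * p.1)) p.2)
    (g := fun p => K (clamp01 (2 * p.1 - 1)) p.2)).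
  + by apply: continuous_subspaceT => p; contauto.
  + apply: continuous_subspaceT => p.
    refine (cont_comp (f := fun p : R * X => (clamp01 (2 * p.1), p.2)) cH _).
    by contauto.
  + apply: continuous_subspaceT => p.
    refine (cont_comp (f := fun p : R * X => (clamp01 (2 * p.1 - 1), p.2)) cK _).
    by contauto.
  + move=> p _ p1; rewrite p1 subrr.
    by rewrite !clamp01_id ?lexx ?ler01 // H1 K0.
- by rewrite mulr0 ler01 clamp01_id ?H0 // lexx ler01.
- rewrite mulr1 ifF; last by apply/negbTE; rewrite -ltNge ltr1n.
  by rewrite (_ : 2 - 1 = 1) ?clamp01_id ?K1 ?lexx ?ler01 //; ring.
- by case: ifP => _; rewrite ?Hx // Kx -H1 Hx.
Qed.

Lemma ptd_homotopic_compl X Y Z (x0 : X) (f g : X -> Y) (h : Y -> Z) :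
  continuous h -> ptd_homotopic x0 f g -> ptd_homotopic x0 (h \o f) (h \o g).
Proof.
move=> ch [H [cH H0 H1 Hx]]; exists (fun t => h \o H t); split => [p|x|x|t] /=.
- by refine (cont_comp ch _); exact: cH.
- by rewrite H0.
- by rewrite H1.
- by rewrite Hx.
Qed.

Lemma ptd_homotopic_compr X Y Z (x0 : X) (y0 : Y) (f : X -> Y) (g h : Y -> Z) :
  continuous f -> f x0 = y0 -> ptd_homotopic y0 g h ->
  ptd_homotopic x0 (g \o f) (h \o f).
Proof.
move=> cf fx [H [cH H0 H1 Hx]]; exists (fun t => H t \o f); split => [p|x|x|t] /=.
- by refine (cont_comp (f := fun p : R * X => (p.1, f p.2)) cH _); contauto.
- exact: H0.
- exact: H1.
- by rewrite fx Hx.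
Qed.

(* A formula that makes sense only on part of an ambient space [S], and only
   for times in [0, 1], still defines a homotopy. *)
Lemma ptd_homotopic_within (S : topologicalType) (A : set S) Y
    (x0 : set_type A) (f g : set_type A -> Y) (H : R * S -> Y) :
  {within [set p | 0 <= p.1 <= 1 /\ A p.2], continuous H} ->
  (forall x, H (0, set_val x) = f x) -> (forall x, H (1, set_val x) = g x) ->
  (forall t, 0 <= t <= 1 -> H (t, set_val x0) = f x0) ->
  ptd_homotopic x0 f g.
Proof.
move=> cH H0 H1 Hx; exists (fun t x => H (clamp01 t, set_val x)).
split => [|x|x|t].
- apply: (continuous_compW (h := fun p : R * set_type A =>
    (clamp01 p.1, set_val p.2)) cH) => [p|p] /=.
    by split; [exact: clamp01_itv|exact: set_valP].
  by contauto.
- by rewrite clamp01_id ?lexx ?ler01.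
- by rewrite clamp01_id ?lexx ?ler01.
- by rewrite Hx // clamp01_itv.
Qed.

Lemma ptd_homotopic_homotopic X Y (x0 : X) (f g : X -> Y) :
  ptd_homotopic x0 f g -> homotopic R f g.
Proof.
move=> [H [cH H0 H1 _]]; exists (fun p => H p.2 p.1); split => //.
apply: continuous_subspaceT => p.
by refine (cont_comp (f := fun p : X * R => (p.2, p.1)) cH _); contauto.
Qed.

Definition ptd_equiv X (x0 : X) Y (y0 : Y) :=
  exists (f : X -> Y) (g : Y -> X),
    [/\ continuous f /\ continuous g, f x0 = y0, g y0 = x0,
        ptd_homotopic x0 (g \o f) id & ptd_homotopic y0 (f \o g) id].

Lemma ptd_equiv_sym X (x0 : X) Y (y0 : Y) :
  ptd_equiv x0 y0 -> ptd_equiv y0 x0.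
Proof. by move=> [f [g [[cf cg] fx gy fg gf]]]; exists g, f. Qed.

Lemma ptd_equiv_homeo X (x0 : X) Y (y0 : Y) (f : X -> Y) (g : Y -> X) :
  continuous f -> continuous g -> cancel f g -> cancel g f -> f x0 = y0 ->
  ptd_equiv x0 y0.
Proof.
move=> cf cg fK gK fx; exists f, g; split => //; first by rewrite -fx fK.
  rewrite (_ : g \o f = id); last exact/funext.
  by apply: ptd_homotopic_refl => x; exact: cvg_id.
rewrite (_ : f \o g = id); last exact/funext.
by apply: ptd_homotopic_refl => x; exact: cvg_id.
Qed.

Lemma ptd_equiv_trans X (x0 : X) Y (y0 : Y) Z (z0 : Z) :
  ptd_equiv x0 y0 -> ptd_equiv y0 z0 -> ptd_equiv x0 z0.
Proof.
move=> [f [g [[cf cg] fx gy gf fg]]] [h [k [[ch ck] hy kz kh hk]]].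
exists (h \o f), (g \o k); split => /=.
- by split=> a; [exact: continuous_comp (cf a) (ch _)|exact: continuous_comp (ck a) (cg _)].
- by rewrite fx.
- by rewrite kz.
- apply: ptd_homotopic_trans gf.
  exact: (ptd_homotopic_compl cg (ptd_homotopic_compr cf fx kh)).
- apply: ptd_homotopic_trans hk.
  exact: (ptd_homotopic_compl ch (ptd_homotopic_compr ck kz fg)).
Qed.

Lemma ptd_equiv_homotopy_equivalent X (x0 : X) Y (y0 : Y) :
  ptd_equiv x0 y0 -> homotopy_equivalent R X Y.
Proof.
move=> [f [g [[cf cg] _ _ gf fg]]]; exists f, g; split => //.
  exact: ptd_homotopic_homotopic gf.
exact: ptd_homotopic_homotopic fg.
Qed.

Section Wedge.
Variables (I : finType) (X : I -> topologicalType) (x : forall i, X i).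

Lemma wedge_surj (w : wedge x) : exists i (a : X i), w = wedge_lift x a.
Proof.
have : [set: wedge x] w by [].
by rewrite -wedgeTE => -[i _ [a _ <-]]; exists i, a.
Qed.

(** Since base points stay fixed, the summandwise homotopies agree at the wedge point at every time
    and glue. Finiteness of [I] and closed base points serve the joint continuity in time and
    space. *)
Lemma ptd_homotopic_wedge (Z : topologicalType) (f g : wedge x -> Z) (i0 : I) :
  (forall i, closed [set x i]) ->
  (forall i, ptd_homotopic (x i) (f \o wedge_lift x (i := i))
                                (g \o wedge_lift x (i := i))) ->
  ptd_homotopic (wedge_lift x (x i0)) f g.
Proof.
move=> clx /(_ _)/cid H.
pose k i := sval (H i).
have kE i t j : k i t (x i) = k j t (x j).
  have [_ _ _ kx] := svalP (H i); have [_ _ _ kx'] := svalP (H j).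
  by rewrite /k kx kx' /=; congr f; exact: wedge_liftE (x j) _ (x i).
have kE' t i j : k i t (x i) = k j t (x j) by exact: kE.
exists (fun t => wedge_fun (fun i => k i t)); split.
- have ck i : continuous (uncurry (k i)).
    rewrite (_ : uncurry _ = fun p => k i p.1 p.2); last by apply/funext => -[].
    by have [] := svalP (H i).
  have := @wedge_fun_joint_continuous _ _ x _ _ k finite_finset clx kE' ck.
  rewrite [X in continuous X -> _](_ : _ =
    fun p => wedge_fun (fun i => k i p.1) p.2); last by apply/funext => -[].
  by [].
- move=> w; have [i [a ->]] := wedge_surj w.
  by rewrite wedge_lift_funE // /k; have [_ ->] := svalP (H i).
- move=> w; have [i [a ->]] := wedge_surj w.
  by rewrite wedge_lift_funE // /k; have [_ _ ->] := svalP (H i).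
- by move=> t; rewrite wedge_lift_funE // /k; have [_ _ _ ->] := svalP (H i0).
Qed.
End Wedge.

End PtdHomotopy.

Lemma wedge_map_continuous (I J : choiceType)
    (X : I -> topologicalType) (Y : J -> topologicalType)
    (x : forall i, X i) (y : forall j, Y j) (h : I -> J)
    (f : forall i, X i -> Y (h i)) :
  (forall i, continuous (f i)) -> (forall i, f i (x i) = y (h i)) ->
  let F := wedge_fun (p0 := x) (fun i a => wedge_lift y (f i a)) in
  continuous F /\ forall i a, F (wedge_lift x a) = wedge_lift y (f i a).
Proof.
move=> cf fx F; have fE i j : wedge_lift y (f i (x i)) = wedge_lift y (f j (x j)).
  by rewrite !fx; exact: wedge_liftE.
split; last by move=> i a; rewrite /F wedge_lift_funE.
apply: wedge_fun_continuous => // i a.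
by refine (cont_comp (@wedge_lift_continuous _ _ y _) _); exact: cf.
Qed.

Lemma ptd_equiv_wedge (R : realType) (I : finType) (X Y : I -> topologicalType)
    (x : forall i, X i) (y : forall i, Y i) (i0 : I) :
  (forall i, closed [set x i]) -> (forall i, closed [set y i]) ->
  (forall i, ptd_equiv R (x i) (y i)) ->
  ptd_equiv R (wedge_lift x (x i0)) (wedge_lift y (y i0)).
Proof.
move=> clx cly /(_ _)/cid Hf; pose f i := sval (Hf i).
have Hg i := cid (svalP (Hf i)); pose g i := sval (Hg i).
have H i : [/\ continuous (f i) /\ continuous (g i), f i (x i) = y i,
    g i (y i) = x i, ptd_homotopic R (x i) (g i \o f i) id
    & ptd_homotopic R (y i) (f i \o g i) id] := svalP (Hg i).
have [|i|cF FE] := @wedge_map_continuous _ _ _ _ x y id f.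
- by move=> i; have [[]] := H i.
- by have [] := H i.
have [|i|cG GE] := @wedge_map_continuous _ _ _ _ y x id g.
- by move=> i; have [[]] := H i.
- by have [] := H i.
eexists; eexists; split; [split; [exact: cF|exact: cG]|..].
- by rewrite FE; have [_ ->] := H i0.
- by rewrite GE; have [_ _ ->] := H i0.
- apply: ptd_homotopic_wedge => // i; have [_ _ _ gf _] := H i.
  have := ptd_homotopic_compl (@wedge_lift_continuous _ _ x i) gf.
  by congr ptd_homotopic; apply/funext => a /=; rewrite FE GE.
- apply: ptd_homotopic_wedge => // i; have [_ _ _ _ fg] := H i.
  have := ptd_homotopic_compl (@wedge_lift_continuous _ _ y i) fg.
  by congr ptd_homotopic; apply/funext => a /=; rewrite GE FE.
Qed.

(** Even a homeomorphism: in both spaces a point comes from an innermost summand, and all base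
    points are identified. *)
Lemma ptd_equiv_wedge_flatten (R : realType) (I : finType) (J : I -> finType)
    (X : forall i, J i -> topologicalType) (x : forall i j, X i j)
    (j0 : forall i, J i) (i0 : I) (p0 : {i & J i}) :
  ptd_equiv R
    (wedge_lift (fun i => wedge_lift (x i) (x i (j0 i)))
       (wedge_lift (x i0) (x i0 (j0 i0))))
    (wedge_lift (X := fun p : {i & J i} => X (tag p) (tagged p))
       (fun p => x (tag p) (tagged p)) (x (tag p0) (tagged p0))).
Proof.
pose XX := fun p : {i & J i} => X (tag p) (tagged p).
pose y := fun i => wedge_lift (x i) (x i (j0 i)).
pose z : forall p, XX p := fun p => x (tag p) (tagged p).
rewrite -/(y i0) -/y -/XX -/z -/(z p0).
have xE i j : wedge_lift (x i) (x i j) = y i by exact: wedge_liftE.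
have zE i j p : wedge_lift z (i := Tagged J j) (x i j) = wedge_lift z (z p).
  exact: (@wedge_liftE _ _ z p (z p) (Tagged J j) (x i j)).
pose G (w : wedge z) : wedge y :=
  wedge_fun (fun p a => wedge_lift y (wedge_lift (x (tag p)) a)) w.
have GE p a : G (wedge_lift z a) = wedge_lift y (wedge_lift (x (tag p)) (i := tagged p) a).
  rewrite /G wedge_lift_funE // => -[i j] [i' j'] /=.
  rewrite /z/= !xE.
  exact: wedge_liftE.
have cG : continuous G.
  apply: wedge_fun_continuous => [[i j] a|[i j] [i' j'] /=].
    refine (cont_comp (@wedge_lift_continuous _ _ y i) _).
    exact: (@wedge_lift_continuous _ _ (x i) j).
  rewrite /z/= !xE.
  exact: wedge_liftE.
pose k i (w : wedge (x i)) : wedge z :=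
  wedge_fun (fun j a => wedge_lift z (i := Tagged J j) a) w.
have kE i j a : k i (wedge_lift (x i) a) = wedge_lift z (i := Tagged J j) a.
  by rewrite /k wedge_lift_funE.
have ck i : continuous (k i).
  apply: wedge_fun_continuous => [j a|j1 j2].
    exact: (@wedge_lift_continuous _ _ z (Tagged J j)).
  exact: (zE _ _ (Tagged J j2)).
pose F (w : wedge y) : wedge z := wedge_fun (fun i a => k i a) w.
have kyE i j : k i (y i) = k j (y j).
  rewrite /y !kE; exact: (zE i (j0 i) (Tagged J (j0 j))).
have FE i a : F (wedge_lift y a) = k i a by rewrite /F wedge_lift_funE.
have cF : continuous F by exact: wedge_fun_continuous.
apply: (@ptd_equiv_homeo R _ _ _ _ F G cF cG).
- move=> w; have [i [{}w ->]] := wedge_surj w; have [j [a ->]] := wedge_surj w.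
  by rewrite FE kE GE.
- by move=> w; have [[i j] [a ->]] := wedge_surj w; rewrite GE FE kE.
- rewrite FE kE; exact: zE.
Qed.

Section Reindex.
Variables (R : realType) (Z : nat -> topologicalType) (z : forall m, Z m).

(** The types [Z (d i)] and [Z (d' (h i))] agree only through a proof that the dimensions are equal,
    so the homeomorphism has to transport along it. *)
Let cast m n (e : m = n) (a : Z m) : Z n := eq_rect m Z a n e.

Lemma ptd_equiv_wedge_reindex (I J : finType) (d : I -> nat) (d' : J -> nat)
    (i0 : I) (j0 : J) (h : I -> J) :
  bijective h -> (forall i, d i = d' (h i)) ->
  ptd_equiv R (wedge_lift (fun i => z (d i)) (z (d i0)))
              (wedge_lift (fun j => z (d' j)) (z (d' j0))).
Proof.
move=> [k hk kh] dh; have dk j : d' j = d (k j) by rewrite dh kh.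
have ccast m n (e : m = n) : continuous (cast e) by case: n / e => a; exact: cvg_id.
have castz m n (e : m = n) : cast e (z m) = z n by case: n / e.
have [|i|cF FE] := @wedge_map_continuous _ _ _ _ (fun i => z (d i))
    (fun j => z (d' j)) h (fun i => cast (dh i)) => //.
have [|i|cG GE] := @wedge_map_continuous _ _ _ _ (fun j => z (d' j))
    (fun i => z (d i)) k (fun j => cast (dk j)) => //.
(* A round trip transports along a proof of [D a = D b] with [a = b]; equality proofs in [nat] being
   unique, nothing moves. *)
have casts (K : finType) (D : K -> nat) a b c (e1 : D a = c) (e2 : c = D b) w :
    a = b -> wedge_lift (fun i => z (D i)) (cast e2 (cast e1 w)) =
             wedge_lift (fun i => z (D i)) w.
  move=> ab; subst b; rewrite (eq_irrelevance e2 (esym e1)).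
  by move: e2; case: c / e1 => _.
apply: (@ptd_equiv_homeo R _ _ _ _ _ _ cF cG).
- move=> w; have [i [a ->]] := wedge_surj w; rewrite FE GE; exact: casts.
- move=> w; have [i [a ->]] := wedge_surj w; rewrite GE FE; exact: casts.
- by rewrite FE castz; exact: wedge_liftE.
Qed.

End Reindex.

Lemma perm_eq_bij (I J : finType) (d : I -> nat) (d' : J -> nat) :
  perm_eq [seq d i | i <- enum I] [seq d' j | j <- enum J] ->
  exists2 h : I -> J, bijective h & forall i, d i = d' (h i).
Proof.
move=> /[dup] /perm_size; rewrite !size_map -!enumT -!cardE => cIJ.
move=> /(perm_iotaP 0%N)[Is pIs dE].
(* [nth] on [enum J] needs a default element, so an empty [J] is treated apart. *)
have [j0 _|J0] := pickP [pred j : J | true]; last first.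
  have I0 : #|I| = 0%N by rewrite cIJ; apply: eq_card0 => j; have := J0 j.
  have I0' (i : I) : False by have := card0_eq I0 i.
  exists (fun i => False_rect _ (I0' i)) => [|i]; last by case: (I0' i).
  have J0' (j : J) : False by have := J0 j.
  by exists (fun j => False_rect _ (J0' j)) => [i|j]; [case: (I0' i)|case: (J0' j)].
rewrite size_map -cardE in pIs.
have sIs : size Is = #|J| by rewrite (perm_size pIs) size_iota.
have uIs : uniq Is by rewrite (perm_uniq pIs) iota_uniq.
have IsJ a : (a < #|J|)%N -> (nth 0%N Is a < #|J|)%N.
  move=> aJ; have : nth 0%N Is a \in Is by rewrite mem_nth // sIs.
  by rewrite (perm_mem pIs) mem_iota add0n.
have ri (i : I) : (enum_rank i < #|J|)%N by rewrite -cIJ.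
exists (fun i => nth j0 (enum J) (nth 0%N Is (enum_rank i))).
  apply: inj_card_bij; last by rewrite cIJ.
  move=> i1 i2 /eqP; rewrite nth_uniq ?enum_uniq -?cardE ?IsJ //.
  by rewrite nth_uniq ?sIs // => /eqP/val_inj/enum_rank_inj.
move=> i; have := congr1 (fun s => nth 0%N s (enum_rank i)) dE.
rewrite (nth_map i) -?cardE // (nth_map 0%N) ?sIs // (nth_map j0) -?cardE ?IsJ //.
by move=> <-; rewrite -enum_val_nth enum_rankK.
Qed.

(** * Splitting off a pair of coordinates *)

Definition nonzero (R : realType) (V : normedModType R) (C : set V) : set V :=
  [set z | C z /\ z != 0].

Section Splitting.
Variables (R : realType) (V : normedModType R).
(** Intended reading: [p] projects onto the plane of the pair (a, b), [rho] reads coordinate a, [r]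
    is the unit vector of a, [e] is the base point and [A] is K'. *)
Variables (p : {linear V -> V}) (rho : V -> R) (e u r : V) (L A : set V).
Hypotheses (p_cont : continuous p) (rho_cont : continuous rho).
Hypotheses (pK : forall z, p (p z) = p z) (pr : p r = r) (r0 : r != 0).
Hypothesis L_lin : forall a b x y, L x -> L y -> L (a *: x + b *: y).
Hypothesis Lp : forall z, L z -> p z = 0.
Hypothesis rhoE : forall x s, L x -> rho (x + s *: r) = s.
Hypotheses (Le : L e) (e0 : e != 0) (Lu : L u).
Hypotheses (AL : A `<=` L) (A0 : A 0).
(** Segments from [A] to [e] stay in [A], so that a bent path leaves it only through its bend. *)
Hypothesis A_cone : forall (a : V) (s t : R), A a -> 0 <= s -> 0 <= t -> A (s *: a + t *: e).
Hypothesis Au : forall (a : V) (s : R), A a -> 0 <= s -> a + s *: u = 0 -> s = 0.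

Let q (z : V) : V := z - p z.

(** [B], [Y] and [Z] are the cones K' x R, K' x R^2 and K of the overview. *)
Let B : set V := [set z | A (q z) /\ p z = rho z *: r].
Let Y : set V := [set z | A (q z)].
Let Z : set V := [set z | L z \/ A (q z)].

Let Ae : A e.
Proof. by have := A_cone A0 ler01 ler01; rewrite scaler0 add0r scale1r. Qed.

Let q_cont : continuous q.
Proof. by move=> z; rewrite /q; contauto. Qed.

Let Lq z : L z -> q z = z.
Proof. by move=> /Lp pz; rewrite /q pz subr0. Qed.

Let qp z : p (q z) = 0.
Proof. by rewrite /q linearB /= pK subrr. Qed.

Let qD x y : q (x + y) = q x + q y.
Proof. by rewrite /q linearD /= opprD addrACA. Qed.

Let qZ s x : q (s *: x) = s *: q x.
Proof. by rewrite /q linearZ /= scalerBr. Qed.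

Let qr : q r = 0.
Proof. by rewrite /q pr subrr. Qed.

Let qe : q e = e. Proof. exact: Lq. Qed.
Let pe : p e = 0. Proof. exact: Lp. Qed.

Let qA a : A a -> q a = a. Proof. by move=> /AL/Lq. Qed.

Let qqp z : q (p z) = 0. Proof. by rewrite /q pK subrr. Qed.

(** * Bent paths and loops that avoid the origin *)

Let admissible (d : V) := forall (a : V) (s : R), A a -> 0 <= s -> a + s *: d = 0 -> s = 0.

Let adm_r : admissible r.
Proof.
move=> a s /AL/Lp pa s0 /(congr1 p); rewrite linearD linearZ /= pa pr add0r linear0.
by move/eqP; rewrite scaler_eq0 (negbTE r0) orbF => /eqP.
Qed.

Let adm_Nr : admissible (- r).
Proof.
move=> a s /AL/Lp pa s0 /(congr1 p).
rewrite linearD linearZ linearN /= pa pr add0r linear0.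
by move/eqP; rewrite scaler_eq0 oppr_eq0 (negbTE r0) orbF => /eqP.
Qed.

(* The path from [x] to [e] which is bent towards [d]; it is constant when
   [x = e]. *)
Let push (x : V) (s : R) (d : V) : V := (1 - s) *: x + s *: e + (s * (1 - s) * `|e - x|) *: d.

Let push0 x d : push x 0 d = x.
Proof. by rewrite /push subr0 scale1r scale0r !mul0r scale0r !addr0. Qed.

Let push1 x d : push x 1 d = e.
Proof. by rewrite /push subrr scale0r scale1r mulr0 mul0r scale0r addr0 add0r. Qed.

Let pushe s d : push e s d = e.
Proof. by rewrite /push subrr normr0 mulr0 scale0r addr0 -scalerDl subrK scale1r. Qed.

Let regroup a k s c d : (1 - s) *: (a + k *: d) + s *: e + c *: d =
  (1 - s) *: a + s *: e + ((1 - s) * k + c) *: d.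
Proof.
rewrite scalerDr scalerA [((1 - s) * k + c) *: d]scalerDl addrA.
by congr (_ + _); rewrite addrAC.
Qed.

(** By [regroup] the path is always a point of [A] plus a nonnegative multiple of [d]. At 0,
    admissibility would make the multiple vanish, but for [0 < s < 1] and [x != e] the bend alone
    makes it positive. The start may already be displaced along [d], as happens in [H1]. *)
Let push_neq0 d a k x s : admissible d -> A a -> 0 <= k -> x = a + k *: d ->
  x != 0 -> 0 <= s <= 1 -> push x s d != 0.
Proof.
move=> ad Aa k0 xE x0 /andP[s0 s1]; have s1' : 0 <= 1 - s by rewrite subr_ge0.
have [->|xe] := eqVneq x e; first by rewrite pushe.
have [->|s10] := eqVneq s 1; first by rewrite push1.
have [->|s00] := eqVneq s 0; first by rewrite push0.
apply/eqP => P0.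
have c0 : 0 <= (1 - s) * k + s * (1 - s) * `|e - x|.
  by rewrite addr_ge0 ?mulr_ge0.
have : (1 - s) * k + s * (1 - s) * `|e - x| = 0.
  apply: (ad _ _ (A_cone Aa s1' s0)) => //; rewrite -P0 /push.
  by rewrite -regroup -xE.
apply/eqP; rewrite gt_eqF // ltr_wpDl ?mulr_ge0 // !mulr_gt0 //.
- by rewrite lt_def s00.
- by rewrite lt_def s1' subr_eq0 eq_sym s10.
- by rewrite normr_gt0 subr_eq0 eq_sym.
Qed.

Let push_neq0A d a s : admissible d -> A a -> a != 0 -> 0 <= s <= 1 ->
  push a s d != 0.
Proof.
by move=> ad Aa; apply: (push_neq0 (a := a) (k := 0)) => //; rewrite scale0r addr0.
Qed.

Let push_u_L x s : L x -> L (push x s u).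
Proof.
move=> Lx; rewrite /push -[(1 - s) *: x + s *: e]scale1r.
by apply: L_lin => //; exact: L_lin.
Qed.

Let q_push_r x s : q (push x s r) = (1 - s) *: q x + s *: e.
Proof. by rewrite /push !qD !qZ qr qe scaler0 addr0. Qed.

Let push_r_Y x s : 0 <= s <= 1 -> Y x -> Y (push x s r).
Proof.
move=> /andP[s0 s1] Yx; rewrite /Y /= q_push_r.
by apply: A_cone => //; rewrite subr_ge0.
Qed.

(* The loop at [e] through [x] in the suspension of [A]. *)
Let loop (x : V) (s : R) : V := (1 - `|s|) *: x + `|s| *: e + (s * (1 - `|s|) * `|e - x|) *: r.

Let loop_ge0 x s : 0 <= s -> loop x s = push x s r.
Proof. by move=> s0; rewrite /loop ger0_norm. Qed.

Let loop_le0 x s : s <= 0 -> loop x s = push x (- s) (- r).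
Proof. by move=> s0; rewrite /loop /push ler0_norm // !mulNr scalerN -scaleNr !opprK. Qed.

Let loope s : loop e s = e.
Proof. by have [/loop_ge0|/ltW/loop_le0] := leP 0 s => ->; rewrite pushe. Qed.

Let loop1 x s : `|s| = 1 -> loop x s = e.
Proof. by move=> s1; rewrite /loop s1 subrr mulr0 mul0r !scale0r scale1r add0r addr0. Qed.

Let loop_neq0 x s : -1 <= s <= 1 -> A x -> (x = 0 -> `|s| = 1) -> loop x s != 0.
Proof.
move=> /andP[s1 s1'] Ax; have [-> /(_ erefl)/loop1 ->//|x0 _] := eqVneq x 0.
have [s0|/ltW s0] := leP 0 s.
  by rewrite loop_ge0 //; apply: push_neq0A => //; rewrite s0.
by rewrite loop_le0 //; apply: push_neq0A => //; rewrite oppr_ge0 s0 lerNl.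
Qed.

Let rhoL x : L x -> rho x = 0.
Proof. by move=> Lx; have := rhoE 0 Lx; rewrite scale0r addr0. Qed.

Let loop_B x s : -1 <= s <= 1 -> A x -> B (loop x s).
Proof.
move=> s1 Ax; have s1' : 0 <= 1 - `|s| by rewrite subr_ge0 ler_norml.
have Al : A ((1 - `|s|) *: x + `|s| *: e) by exact: A_cone.
rewrite /B /= /loop qD qZ qr scaler0 addr0 (qA Al); split => //.
by rewrite linearD linearZ /= (Lp (AL Al)) pr add0r (rhoE _ (AL Al)).
Qed.

(* [T] runs from 0 (where [p z = 0]) to 8 (where [q z = 0]); the factor 8 makes
   the thresholds 1, 3, 4 of the gluing below integers. *)
Let T (z : V) : R := 8 * (`|p z| / (`|q z| + `|p z|)).

Let den_gt0 z : z != 0 -> 0 < `|q z| + `|p z|.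
Proof.
move=> z0; rewrite lt_def addr_ge0 // andbT paddr_eq0 // !normr_eq0.
apply: contra z0 => /andP[/eqP qz /eqP pz].
by rewrite -(subrK (p z) z) -/(q z) qz pz addr0.
Qed.

Let T_cont z : z != 0 -> continuous_at z T.
Proof.
move=> z0; rewrite /T; have dz : `|q z| + `|p z| != 0 by rewrite gt_eqF ?den_gt0.
have := @cont_inv _ _ (fun z => `|q z| + `|p z|) _ dz.
move=> ci; have {}ci : continuous_at z (fun y => (`|q y| + `|p y|)^-1).
  by apply: ci; contauto.
by contauto.
Qed.

Let T_itv z : z != 0 -> 0 <= T z <= 8.
Proof.
move=> z0; have d0 := den_gt0 z0; apply/andP; split.
  by rewrite mulr_ge0 // divr_ge0 // ltW.
by rewrite ler_piMr // ler_pdivrMr // mul1r lerDr.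
Qed.

Let T0 z : p z = 0 -> T z = 0.
Proof. by move=> pz; rewrite /T pz normr0 mul0r mulr0. Qed.

Let T8 z : z != 0 -> q z = 0 -> T z = 8.
Proof.
move=> z0 qz; have := den_gt0 z0; rewrite /T qz normr0 add0r => pz.
by rewrite divff ?mulr1 // gt_eqF.
Qed.

Let sg (t : R) : R := Num.max 0 (4 - t).
Let nu (t : R) : R := Num.max 0 ((t - 4) / 4).

Let sg_itv t : 3 <= t -> 0 <= sg t <= 1.
Proof. by move=> t3; rewrite /sg le_max lexx /= ge_max ler01 /=; lra. Qed.

(** The walk along [r] ends before [p z] starts to come back: with [p z] opposite to [r], the bent
    path could run into 0. *)
Let nu_sg t : sg t = 0 \/ nu t = 0.
Proof.
have [t4|t4] := leP 4 t; [left|right]; rewrite /sg /nu; apply/max_idPl; lra.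
Qed.

Let sg4 t : 4 <= t -> sg t = 0. Proof. by move=> t4; apply/max_idPl; lra. Qed.
Let nu4 t : t <= 4 -> nu t = 0. Proof. by move=> t4; apply/max_idPl; lra. Qed.
Let nu8 : nu 8 = 1.
Proof. by rewrite /nu (_ : (8 - 4) / 4 = 1) ?max_r //; lra. Qed.

Let Be : B e.
Proof. by rewrite /B /= qe pe (rhoL Le) scale0r. Qed.

Let Ye : Y e. Proof. by rewrite /Y /= qe. Qed.

(** * The wedge and the map from the cone to it *)

Definition summand (i : 'I_3) : set V :=
  nonzero (if val i == 0 then L else if val i == 1 then B else Y).

Lemma summand_base i : summand i e.
Proof. by rewrite /summand /nonzero /=; do 2?case: ifP => _. Qed.

Definition summand_pt i : set_type (summand i) := set_pt (summand_base i).

Lemma total_base : nonzero Z e. Proof. by split => //; left. Qed.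

Definition total_pt : set_type (nonzero Z) := set_pt total_base.

Let W : topologicalType := wedge summand_pt.
Let inW i v : W := wedge_lift summand_pt (clip (summand_pt i) v).
Let w0 : W := wedge_lift summand_pt (summand_pt ord0).
Let iL : 'I_3 := @Ordinal 3 0 isT.
Let iB : 'I_3 := @Ordinal 3 1 isT.
Let iY : 'I_3 := @Ordinal 3 2 isT.

Let inW_base i : inW i e = w0.
Proof.
rewrite /inW -[e in clip _ e]/(set_val (summand_pt i)) clipK.
exact: (@wedge_liftE _ _ summand_pt ord0 (summand_pt ord0) i (summand_pt i)).
Qed.

Let inW_cont (S : topologicalType) (D : set S) i (phi : S -> V) :
  (forall x, D x -> continuous_at x phi) ->
  (forall x, D x -> summand i (phi x)) ->
  {within D, continuous (fun x => inW i (phi x))}.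
Proof.
move=> cphi Dphi; have cD : {within D, continuous phi} by exact: within_continuous_at.
have := continuous_clip (a := summand_pt i) cD Dphi.
move=> /within_continuousP ck; apply/within_continuousP => x Dx U Ux.
have lU : nbhs (clip (summand_pt i) (phi x)) (@wedge_lift _ _ summand_pt i @^-1` U).
  exact: (@wedge_lift_continuous _ _ summand_pt i _ _ Ux).
by apply: filterS (ck x Dx _ lU) => y.
Qed.

Let glue (x y z : V) (t : R) : W :=
  if t <= 1 then inW iL x else if t <= 3 then inW iB y else inW iY z.

(** The three formulas land in different summands; continuity across the thresholds 1 and 3 comes
    from both sides being at [e], that is, at the wedge point. *)
Let glue_cont (S : topologicalType) (D : set S) (t : S -> R) (x y z : S -> V) :
  (forall s, D s -> continuous_at s t) ->
  (forall s, D s -> t s <= 1 -> continuous_at s x /\ nonzero L (x s)) ->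
  (forall s, D s -> 1 <= t s <= 3 -> continuous_at s y /\ nonzero B (y s)) ->
  (forall s, D s -> 3 <= t s -> continuous_at s z /\ nonzero Y (z s)) ->
  (forall s, D s -> t s = 1 -> x s = e /\ y s = e) ->
  (forall s, D s -> t s = 3 -> y s = e /\ z s = e) ->
  {within D, continuous (fun s => glue (x s) (y s) (z s) (t s))}.
Proof.
move=> ct cx cy cz xy yz; apply: (within_paste3 (T := t)).
- by rewrite ltr1n.
- exact: within_continuous_at.
- by apply: inW_cont => s [Ds ts]; [have [] := cx s Ds ts|have [_] := cx s Ds ts].
- by apply: inW_cont => s [Ds ts]; [have [] := cy s Ds ts|have [_] := cy s Ds ts].
- by apply: inW_cont => s [Ds ts]; [have [] := cz s Ds ts|have [_] := cz s Ds ts].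
- by move=> s Ds ts; have [-> ->] := xy s Ds ts; rewrite !inW_base.
- by move=> s Ds ts; have [-> ->] := yz s Ds ts; rewrite !inW_base.
Qed.

(* As [t] grows, [q z] first slides to [e] inside [L], then runs through the
   loop in [B], then comes back from [e] inside [Y], where from [t = 4] on the
   component [p z] is gradually restored. The map [Z -> W] is [G z (T z)], and
   raising [t] to 8 deforms its restriction to [Y] into the inclusion. *)
Let G z t := glue (push (q z) t u) (loop (q z) (t - 2))
  (push (q z + nu t *: p z) (sg t) r) t.

(** More than the graph of [T]: where [A (q z)] holds, [t] moves independently of [z], which the
    homotopy on [Y] uses. Other points of [L] are allowed at [t = 0] only, where the first push is
    still the identity, and [q z = 0] at [t = 8] only, where [p z] is fully restored. *)
Let DG : set (V * R) :=
  [set x | [/\ x.1 != 0, 0 <= x.2 <= 8, A (q x.1) \/ L x.1 /\ x.2 = 0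
             & q x.1 = 0 -> x.2 = 8]].

Let Y_point z t : z != 0 -> A (q z) -> 3 <= t <= 8 -> (q z = 0 -> t = 8) ->
  nonzero Y (push (q z + nu t *: p z) (sg t) r).
Proof.
move=> z0 Az /andP[t3 t8] qt; have st := sg_itv t3.
have Yz : Y (q z + nu t *: p z).
  by rewrite /Y /= qD qZ qqp scaler0 addr0 qA.
split; first exact: push_r_Y.
(* Either the point is on a bent path started in [A], with [q z = 0] excluded because [nu 8 = 1], or
   it is [q z + nu t *: p z]. The latter vanishes only if [q z = 0], hence [t = 8], and then it is
   [z]. *)
have [s0|n0] := nu_sg t; last first.
  rewrite n0 scale0r addr0; apply: push_neq0A => //.
  apply/eqP => /qt t8'; move: n0; rewrite t8' nu8 => /eqP.
  by rewrite oner_eq0.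
rewrite s0 push0; apply/eqP => z0'.
have q0 : q z = 0.
  by have := congr1 q z0'; rewrite qD qZ qqp scaler0 addr0 (qA Az) /q linear0 subr0.
move: z0'; rewrite q0 add0r (qt q0) nu8 scale1r => p0.
by move: z0; rewrite -(subrK (p z) z) -/(q z) q0 p0 addr0 eqxx.
Qed.

Let G_nonzero z t : DG (z, t) -> t != 8 -> q z != 0.
Proof. by move=> [_ _ _ qt]; apply: contra_neq => /qt. Qed.

Let G_A z t : DG (z, t) -> t != 0 -> A (q z).
Proof. by move=> [_ _ [//|[_ /= ->]]]; rewrite eqxx. Qed.

Let G_L z t : DG (z, t) -> t <= 1 -> nonzero L (push (q z) t u).
Proof.
move=> D t1; have qz : q z != 0 by apply: (G_nonzero D); lra.
have [/= z0 /= /andP[t0 _] [Az|[Lz /= ->]] _] := D; last first.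
  by rewrite push0; split; rewrite ?Lq.
split; first by apply: push_u_L; exact: AL.
by apply: push_neq0A => //; rewrite t0.
Qed.

Let G_B z t : DG (z, t) -> 1 <= t <= 3 -> nonzero B (loop (q z) (t - 2)).
Proof.
move=> D /andP[t1 t3]; have Az : A (q z) by apply: (G_A D); lra.
have t2 : -1 <= t - 2 <= 1 by apply/andP; split; lra.
split; first exact: loop_B.
apply: loop_neq0 => // /eqP; rewrite (negbTE (G_nonzero D _)) //; lra.
Qed.

Let G_Y z t : DG (z, t) -> 3 <= t ->
  nonzero Y (push (q z + nu t *: p z) (sg t) r).
Proof.
move=> D t3; have Az : A (q z) by apply: (G_A D); lra.
by have [z0 /= /andP[_ t8] _ qt] := D; apply: Y_point => //; rewrite t3.
Qed.

Let G_cont : {within DG, continuous (fun x => G x.1 x.2)}.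
Proof.
apply: glue_cont => -[z t] /= D.
- exact: cvg_snd.
- by move=> t1; split; [rewrite /push; contauto|exact: G_L].
- by move=> t1; split; [rewrite /loop; contauto|exact: G_B].
- by move=> t1; split; [rewrite /push /sg /nu; contauto|exact: G_Y].
- by move=> ->; rewrite push1 loop1 // distrC (_ : 2 - 1 = 1) ?normr1 //; lra.
- move=> ->; rewrite loop1; last by rewrite (_ : 3 - 2 = 1) ?normr1 //; lra.
  by rewrite /sg (_ : 4 - 3 = 1) ?max_r ?push1 //; lra.
Qed.

Let G_e t : G e t = w0.
Proof.
rewrite /G qe pe scaler0 addr0 !pushe loope /glue !inW_base.
by do 2?case: ifP.
Qed.

Let DG_T z : nonzero Z z -> DG (z, T z).
Proof.
move=> [[Lz|Az] z0]; split => //=; try exact: T_itv; try exact: T8.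
- by right; split => //; rewrite T0 // Lp.
- by left.
Qed.

Let g (z : set_type (nonzero Z)) : W := G (set_val z) (T (set_val z)).

Let g_cont : continuous g.
Proof.
apply: (continuous_compW (h := fun z : set_type (nonzero Z) =>
  (set_val z, T (set_val z))) G_cont) => z /=.
  by apply: DG_T; exact: set_valP.
have [_ z0] := set_valP z; have cT := T_cont z0.
have cv : continuous_at z (set_val : set_type (nonzero Z) -> V) by exact: continuous_val.
apply: cont_pair => //.
exact: (continuous_comp cv cT).
Qed.

(* Unfolds the negative half-line of [r] onto the half-line of [u]. *)
Let Phi b := q b + Num.max (rho b) 0 *: r + Num.max (- rho b) 0 *: u.

Let B_intro x s : A x -> B (x + s *: r).
Proof.
move=> Ax; rewrite /B /= qD qZ qr scaler0 addr0 (qA Ax); split => //.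
by rewrite linearD linearZ /= (Lp (AL Ax)) pr add0r (rhoE _ (AL Ax)).
Qed.

Let BE b : B b -> b = q b + rho b *: r.
Proof. by move=> [_ <-]; rewrite /q subrK. Qed.

Let Phi_ge0 b : B b -> 0 <= rho b -> Phi b = b.
Proof.
move=> Bb s0; rewrite /Phi max_l // max_r ?oppr_le0 // scale0r addr0.
by rewrite -BE.
Qed.

Let Phi_le0 b : rho b <= 0 -> Phi b = q b + (- rho b) *: u.
Proof. by move=> s0; rewrite /Phi max_r // max_l ?oppr_ge0 // scale0r addr0. Qed.

Let Phi_Z b : nonzero B b -> nonzero Z (Phi b).
Proof.
move=> [Bb b0]; have [Ab _] := Bb; have [s0|/ltW s0] := leP 0 (rho b).
  by rewrite Phi_ge0 //; split => //; right.
rewrite Phi_le0 //; split; first left.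
  by rewrite -[q b]scale1r; apply: L_lin => //; exact: AL.
apply/eqP => P0; have s0' : - rho b = 0 by apply: Au Ab _ P0; rewrite oppr_ge0.
move: P0; rewrite s0' scale0r addr0 => qb.
by move: b0; rewrite (BE Bb) qb -[rho b]opprK s0' oppr0 scale0r addr0 eqxx.
Qed.

(** * The inverse map from the wedge to the cone *)

Let fvec (i : 'I_3) v := if i == iB then Phi v else v.

Let fvecL v : fvec iL v = v. Proof. by []. Qed.
Let fvecB v : fvec iB v = Phi v. Proof. by []. Qed.
Let fvecY v : fvec iY v = v. Proof. by []. Qed.

Let fvec_Z i v : summand i v -> nonzero Z (fvec i v).
Proof.
rewrite /summand /fvec; case: i => -[|[|[|//]]] ? /=.
- by move=> [Lv v0]; split => //; left.
- exact: Phi_Z.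
- by move=> [Yv v0]; split => //; right.
Qed.

Let Phi_e : Phi e = e.
Proof. by rewrite Phi_ge0 // (rhoL Le). Qed.

Let fvec_e i : fvec i e = e.
Proof. by rewrite /fvec Phi_e if_same. Qed.

Let f (w : W) : set_type (nonzero Z) :=
  wedge_fun (fun i (x : set_type (summand i)) =>
    clip total_pt (fvec i (set_val x))) w.

Let fE i (x : set_type (summand i)) :
  f (wedge_lift summand_pt x) = clip total_pt (fvec i (set_val x)).
Proof. by rewrite /f wedge_lift_funE // => j k /=; rewrite !fvec_e. Qed.

Let f_inW i v : summand i v -> f (inW i v) = clip total_pt (fvec i v).
Proof. by move=> iv; rewrite /inW fE val_clip. Qed.

Let f_cont : continuous f.
Proof.
apply: wedge_fun_continuous => [i|j k /=]; last by rewrite !fvec_e.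
apply: (continuous_compW (D := summand i) (h := set_val)
   (phi := fun v => clip total_pt (fvec i v))).
- apply: continuous_clip (@fvec_Z i); apply: within_continuous_at => v _.
  by rewrite /fvec; case: (i == iB); rewrite /Phi; contauto.
- by move=> x; exact: set_valP.
- exact: continuous_val.
Qed.

(** This is why the composite retraces its steps: the half of the loop with [s <= 0] becomes the
    path along [u] run backwards from [e], undoing the slide in [L], and the half with [s >= 0]
    becomes the path along [r], which the return in [Y] undoes. *)
Let Phi_loop x s : -1 <= s <= 1 -> A x -> Phi (loop x s) =
  if 0 <= s then push x s r else push x (- s) u.
Proof.
move=> s11 Ax; have Bl := loop_B s11 Ax.
have /andP[s1 s1'] := s11; have s1'' : 0 <= 1 - `|s| by rewrite subr_ge0 ler_norml.
have Al : A ((1 - `|s|) *: x + `|s| *: e) by exact: A_cone.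
have rl : rho (loop x s) = s * (1 - `|s|) * `|e - x| by exact: rhoE (AL Al).
have [s0|s0] := leP 0 s.
  by rewrite Phi_ge0 ?loop_ge0 // -loop_ge0 // rl !mulr_ge0.
rewrite Phi_le0; last by rewrite rl !mulr_le0_ge0 // ltW.
by rewrite rl /loop qD (qA Al) qZ qr scaler0 addr0 ltr0_norm // /push !mulNr.
Qed.

(** * The composite on the cone is homotopic to the identity *)

Let su (t : R) : R := 1 - `|t - 1|.
(** Like [su], a tent giving the position on one of the walks, with its peak at [t = 3]. It is cut
    off at 0 since [T] runs on to 8, whereas [su] is applied only for [0 <= t <= 2]. *)
Let sr (t : R) : R := Num.max 0 (1 - `|t - 3|).
Let h1 (t : R) : R := Num.max 0 (1 - 2 * t).
Let h2 (t : R) : R := Num.max 0 (2 * t - 1).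

(* The composite [Z -> W -> Z] walks from [q z] to [e] and back, twice. Up to
   time 1/2 the factor [h1] retracts these walks, afterwards [h2] restores
   [p z]. The two stages are kept apart because a point with [p z != 0] that is
   moved along [u] leaves [Z], and one that is moved along [r] may hit 0. *)
Let K (x : R * V) : V :=
  let t := T x.2 in let y := q x.2 + (nu t + h2 x.1 * (1 - nu t)) *: p x.2 in
  if t <= 2 then push y (h1 x.1 * su t) u else push y (h1 x.1 * sr t) r.

Let h12 t : h1 t = 0 \/ h2 t = 0.
Proof.
have [t2|t2] := leP (1 / 2) t; [left|right]; apply/max_idPl; lra.
Qed.

Let q_Y z n : q (q z + n *: p z) = q z.
Proof. by rewrite qD qZ qqp scaler0 addr0 /q qp subr0. Qed.

Let K_Z (x : R * V) : 0 <= x.1 <= 1 -> nonzero Z x.2 -> nonzero Z (K x).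
Proof.
case: x => t z /= /andP[t0 t1] Zz; have D := DG_T Zz; have [LAz z0] := Zz.
have q0 n : q z != 0 -> q z + n *: p z != 0.
  move=> qz; apply: contra_neq qz => /(congr1 q).
  by rewrite q_Y /q linear0 subr0.
have h1i : 0 <= h1 t <= 1 by rewrite /h1 le_max lexx /= ge_max ler01 /=; lra.
have /andP[h10 h11] := h1i.
rewrite /K /=; have [T2|T2] := leP (T z) 2.
  have qz : q z != 0 by apply: (G_nonzero D); lra.
  have [T0' _] := andP (T_itv z0).
  have sui : 0 <= h1 t * su (T z) <= 1.
    have su0 : 0 <= su (T z) by rewrite /su subr_ge0 ler_norml; apply/andP; split; lra.
    have su1 : su (T z) <= 1 by rewrite /su gerBl.
    by rewrite mulr_ge0 //= mulr_ile1.
  have [h0|h0] := h12 t.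
    rewrite h0 mul0r push0; split; last exact: q0.
    case: LAz => [Lz|Az]; last by right; rewrite q_Y.
    by left; rewrite (Lp Lz) scaler0 addr0 (Lq Lz).
  rewrite h0 mul0r addr0 nu4; last by lra.
  (* On [L] the function [T] vanishes, hence so does the tent [su]: points of [L] do not move at
     all. *)
  rewrite scale0r addr0; case: LAz => [Lz|Az].
    by rewrite /su (T0 (Lp Lz)) sub0r normrN1 subrr mulr0 push0 (Lq Lz); split => //; left.
  split; first by left; apply: push_u_L; exact: AL.
  exact: push_neq0A.
have Az : A (q z) by apply: (G_A D); lra.
have sri : 0 <= h1 t * sr (T z) <= 1.
  have sr0 : 0 <= sr (T z) by rewrite /sr le_max lexx.
  have sr1 : sr (T z) <= 1 by rewrite /sr ge_max ler01 /= gerBl.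
  by rewrite mulr_ge0 //= mulr_ile1.
have Yz n : Y (q z + n *: p z) by rewrite /Y /= q_Y.
split; first by right; exact: push_r_Y.
have [hs0|hs0] := eqVneq (h1 t * sr (T z)) 0.
  (* If [q z = 0], then [T z = 8] and [nu 8 = 1], so the coefficient of [p z] is 1 at every time and
     the point is [z] itself. *)
  rewrite hs0 push0; have [qz|/q0->//] := eqVneq (q z) 0.
  rewrite (T8 z0 qz) nu8 subrr mulr0 addr0 scale1r.
  by rewrite /q subrK.
have h1n : h1 t != 0 by apply: contra_neq hs0 => ->; rewrite mul0r.
have srn : sr (T z) != 0 by apply: contra_neq hs0 => ->; rewrite mulr0.
have T4 : T z < 4.
  rewrite ltNge; apply: contra srn => T4; apply/eqP/max_idPl.
  by rewrite ger0_norm; lra.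
have [/eqP|->] := h12 t; first by rewrite (negbTE h1n).
rewrite mul0r addr0 nu4 ?scale0r ?addr0; last exact: ltW.
by apply: push_neq0A => //; apply: (G_nonzero D); lra.
Qed.

Let K_cont : {within [set x : R * V | 0 <= x.1 <= 1 /\ nonzero Z x.2],
  continuous K}.
Proof.
have cT (x : R * V) : nonzero Z x.2 -> continuous_at x (fun x => T x.2).
  by move=> [_ x0]; apply: continuous_comp (T_cont x0); exact: cvg_snd.
apply: within_paste => [|||x _ ->].
- by apply: within_continuous_at => x [_ /cT].
- apply: within_continuous_at => x [[_ /cT cTx] _].
  by rewrite /push /su /nu /h1 /h2; contauto.
- apply: within_continuous_at => x [[_ /cT cTx] _].
  by rewrite /push /sr /nu /h1 /h2; contauto.
- have -> : su 2 = 0 by rewrite /su ger0_norm; lra.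
  have -> : sr 2 = 0 by rewrite /sr ler0_norm ?max_l; lra.
  by rewrite mulr0 !push0.
Qed.

Let fg_homotopic : ptd_homotopic R total_pt (f \o g) id.
Proof.
apply: (ptd_homotopic_within (H := fun x => clip total_pt (K x))).
- by apply: (continuous_clip (a := total_pt) K_cont) => x [x01]; exact: K_Z.
- move=> x; rewrite /= /g; set z := set_val x.
  have Zz : nonzero Z z by exact: set_valP.
  have D := DG_T Zz; have [_ z0] := Zz; have /andP[T0' T8'] := T_itv z0.
  have h10 : h1 0 = 1 by rewrite /h1 mulr0 subr0 max_r.
  have h20 : h2 0 = 0 by rewrite /h2 mulr0 sub0r max_l // lerN10.
  (* Up to the thresholds 1, 2, 3, 4 of [T z] the walk parameters are T, 2 - T, T - 2, 4 - T in
     turn: the flanks of the two tents. *)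
  rewrite /K /= h10 h20 !mul1r mul0r addr0 /G /glue.
  have [T1|T1] := leP (T z) 1.
    rewrite ifT; last by lra.
    rewrite f_inW; last exact: G_L.
    rewrite nu4 ?scale0r ?addr0; last by lra.
    by rewrite /su ler0_norm ?subr_le0 // opprB opprD opprK addrA subrr add0r.
  have [T3|T3] := leP (T z) 3.
    have TB : 1 <= T z <= 3 by rewrite ltW.
    rewrite f_inW /fvec ?eqxx; last exact: G_B.
    rewrite Phi_loop; first last.
    + by apply: (G_A D); lra.
    + by apply/andP; split; lra.
    rewrite nu4 ?scale0r ?addr0; last by lra.
    have [T2|T2] := leP (T z) 2.
      have -> : su (T z) = - (T z - 2) by rewrite /su ger0_norm; lra.
      case: leP => // T2'; have -> : T z = 2 by lra.
      by rewrite subrr oppr0 !push0.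
    rewrite ifT; last by lra.
    by congr (clip _ (push _ _ _)); rewrite /sr ler0_norm ?max_r; lra.
  rewrite ifF; last by apply/negbTE; rewrite -ltNge; lra.
  rewrite f_inW; last by apply: G_Y => //; exact: ltW.
  congr (clip _ (push _ _ _)); rewrite /sr /sg ger0_norm; last by lra.
  by congr Num.max; lra.
- move=> x; rewrite /K /=; set z := set_val x.
  have -> : h1 1 = 0 by rewrite /h1 max_l //; lra.
  have -> : h2 1 = 1 by rewrite /h2 max_r //; lra.
  rewrite !mul0r !push0 mul1r [nu _ + _]addrC subrK scale1r if_same /q subrK.
  exact: clipK.
- move=> t _; rewrite -[set_val total_pt]/e.
  rewrite /K /= pe scaler0 addr0 qe !pushe if_same.
  rewrite /g -[set_val total_pt]/e G_e -(inW_base iL) f_inW ?fvec_e //.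
Qed.

(** * The composite on the wedge, one summand at a time *)

Let g_clip v : nonzero Z v -> g (clip total_pt v) = G v (T v).
Proof. by move=> Zv; rewrite /g val_clip. Qed.

Let inW_lift i (x : set_type (summand i)) :
  inW i (set_val x) = wedge_lift summand_pt x.
Proof. by rewrite /inW clipK. Qed.

Let gfE i (x : set_type (summand i)) : g (f (wedge_lift summand_pt x)) =
  G (fvec i (set_val x)) (T (fvec i (set_val x))).
Proof. by rewrite fE g_clip //; apply: fvec_Z; exact: set_valP. Qed.

Let G_0 v : L v -> G v (T v) = inW iL v.
Proof. by move=> Lv; rewrite T0 ?Lp // /G /glue ler01 push0 Lq. Qed.

(** Here the maps are equal: [T] vanishes on [L], so the walk of [G] has not yet begun. *)
Let gf_L : ptd_homotopic R (summand_pt iL)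
  ((g \o f) \o wedge_lift summand_pt (i := iL)) (wedge_lift summand_pt (i := iL)).
Proof.
rewrite (_ : _ \o _ = wedge_lift summand_pt (i := iL)).
  apply: ptd_homotopic_refl; exact: (@wedge_lift_continuous _ _ summand_pt iL).
apply/funext => x /=; rewrite gfE fvecL G_0 ?inW_lift //.
by have [] := set_valP x.
Qed.

Let gf_Y : ptd_homotopic R (summand_pt iY)
  ((g \o f) \o wedge_lift summand_pt (i := iY)) (wedge_lift summand_pt (i := iY)).
Proof.
(* Raising the time keeps to [DG]: [A (q z)] holds throughout [Y], and where [q z = 0] the time is 8
   from the start. *)
apply: (ptd_homotopic_within
  (H := fun x => G x.2 (Num.max (T x.2) (8 * x.1)))) => [|x|x|t _].
- apply: (within_comp (h := fun x : R * V => (x.2, Num.max (T x.2) (8 * x.1))) G_cont).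
    move=> -[t z] /= [/andP[t0 t1] [Yz z0]].
    have /andP[T0' T8'] := T_itv z0; split => //=.
    + by rewrite le_max T0' /= ge_max T8' /=; lra.
    + by left.
    + by move=> qz; rewrite (T8 z0 qz) max_l //; lra.
  move=> x [_ [_ x0]]; have cT : continuous_at x (fun x => T x.2).
    by apply: continuous_comp (T_cont x0); exact: cvg_snd.
  by contauto.
- rewrite /= gfE fvecY mulr0 max_l //.
  by have [_ /T_itv/andP[]] := set_valP x.
- have [_ x0] := set_valP x; have /andP[T0' T8'] := T_itv x0.
  rewrite max_r ?mulr1 // -inW_lift /G /glue ifF; last by apply/negbTE; rewrite -ltNge; lra.
  rewrite ifF; last by apply/negbTE; rewrite -ltNge; lra.
  by rewrite sg4 ?push0 ?nu8 ?scale1r /q ?subrK //; lra.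
- by rewrite G_e /= gfE fvec_e G_e.
Qed.

(* [T] with the sign of [rho b]. *)
Let Ts b := 8 * (rho b * `|r| / (`|q b| + `|p b|)).

Let Ts_cont b : b != 0 -> continuous_at b Ts.
Proof.
move=> b0; have db : `|q b| + `|p b| != 0 by rewrite gt_eqF ?den_gt0.
have ci : continuous_at b (fun y => (`|q y| + `|p y|)^-1).
  by apply: (cont_inv (f := fun z => `|q z| + `|p z|)) => //; contauto.
by rewrite /Ts; contauto.
Qed.

Let Ts_ge0 b : nonzero B b -> 0 <= rho b -> Ts b = T b.
Proof.
by move=> [[_ pb] _] s0; congr (8 * (_ / _)); rewrite pb normrZ ger0_norm.
Qed.

Let Ts_le0 b : nonzero B b -> rho b <= 0 -> Ts b = - T b.
Proof.
move=> [[_ pb] _] s0; rewrite /T -mulrN -mulNr; congr (8 * (_ / _)).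
by rewrite pb normrZ ler0_norm // mulNr opprK.
Qed.

Let Ts_rho b : 0 <= Ts b * rho b.
Proof.
rewrite /Ts -mulrA mulr_ge0 // mulrAC mulr_ge0 ?invr_ge0 ?addr_ge0 //.
by rewrite mulrAC mulr_ge0 // -expr2 sqr_ge0.
Qed.

Let Ts8 b : nonzero B b -> q b = 0 -> `|Ts b| = 8.
Proof.
move=> Bb qb; have [_ b0] := Bb; have [s0|/ltW s0] := leP 0 (rho b).
  by rewrite Ts_ge0 // T8 // ger0_norm.
by rewrite Ts_le0 // T8 // normrN ger0_norm.
Qed.

Let clamp11 (t : R) : R := Num.max (-1) (Num.min 1 t).

Let clamp11_itv t : -1 <= clamp11 t <= 1.
Proof. by rewrite /clamp11 le_max lexx /= ge_max ge_min lexx /= andbT; lra. Qed.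

Let clamp11_le t : t <= -1 -> clamp11 t = -1.
Proof. by move=> t1; rewrite /clamp11 max_l // ge_min t1 orbT. Qed.

Let clamp11_ge t : 1 <= t -> clamp11 t = 1.
Proof. by move=> t1; rewrite /clamp11 min_l // max_r //; lra. Qed.

Let clamp11_id t : -1 <= t <= 1 -> clamp11 t = t.
Proof. by move=> /andP[t1 t1']; rewrite /clamp11 min_r // max_r. Qed.

Let h_dom : set (R * V) := [set x | 0 <= x.1 <= 1 /\ summand iB x.2].

(* The composite [B -> Z -> W] is deformed into the inclusion in three steps:
   [H1] pushes what lies in [L] or [Y] to [e], [H2] recentres the remaining
   loop, and [H3] is a straight-line homotopy. *)
Let H1 (x : R * V) : W := let t := Ts x.2 in
  glue (push (push (q x.2) (Num.max t 0) u + Num.max (- rho x.2) 0 *: u) x.1 u)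
       (loop (q x.2) (t - 2))
       (push (push (q x.2 + nu t *: p x.2) (sg t) r) x.1 r) t.

Let H2 (x : R * V) : W :=
  inW iB (loop (q x.2) (clamp11 (Ts x.2 - 2 * (1 - x.1)))).

Let H3 (x : R * V) : W :=
  inW iB ((1 - x.1) *: loop (q x.2) (clamp11 (Ts x.2)) + x.1 *: x.2).

Let Ts_cont2 (x : R * V) : h_dom x -> continuous_at x (fun x => Ts x.2).
Proof.
by move=> [_ [_ x0]]; apply: continuous_comp (Ts_cont x0); exact: cvg_snd.
Qed.

Let H1_cont : {within h_dom, continuous H1}.
Proof.
apply: glue_cont => [x|x /[dup] Dx /Ts_cont2 cT T1|x /[dup] Dx /Ts_cont2 cT T1|
    x /[dup] Dx /Ts_cont2 cT T1|x _ T1|x _ ->].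
- exact: Ts_cont2.
- split; first by rewrite /push; contauto.
  case: x Dx {cT} T1 => t b /= [/= t01 [Bb b0]] T1; have [Ab pb] := Bb.
  set y := push (q b) _ u + _.
  pose s := Num.max (Ts b) 0.
  have s01 : 0 <= s <= 1 by rewrite /s le_max lexx orbT /= ge_max T1 ler01.
  have /andP[s0 s1] := s01; have s1' : 0 <= 1 - s by rewrite subr_ge0.
  have Ly : L y.
    by rewrite /y -[push _ _ _]scale1r; apply: L_lin => //; apply: push_u_L; exact: AL.
  split; first exact: push_u_L.
  have m0 : 0 <= Num.max (- rho b) 0 by rewrite le_max lexx orbT.
  (* [k] collects two nonnegative displacements along [u], the bend of the slide and the part due to
     [Phi]. By [Au], [y = 0] forces both to vanish; then [rho b >= 0], and [y] lies on a plain bent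
     path from [q b != 0]. *)
  pose k := s * (1 - s) * `|e - q b| + Num.max (- rho b) 0.
  have k0 : 0 <= k by rewrite addr_ge0 // !mulr_ge0.
  have yE : y = ((1 - s) *: q b + s *: e) + k *: u by rewrite /k [(_ + Num.max _ _) *: u]scalerDl addrA.
  have Ay : A ((1 - s) *: q b + s *: e) by exact: A_cone.
  apply: (push_neq0 (a := (1 - s) *: q b + s *: e) (k := k)) => //.
  apply/eqP => y0; have /eqP := Au Ay k0 (etrans (esym yE) y0).
  rewrite paddr_eq0 // ?mulr_ge0 // => /andP[_ /eqP mr].
  have rb : 0 <= rho b.
    by rewrite -oppr_le0; move: (lexx (Num.max (- rho b) 0)); rewrite {2}mr ge_max => /andP[].
  have qb : q b != 0.
    apply/eqP => qb; have := Ts8 (conj Bb b0) qb; rewrite ger0_norm; first by lra.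
    rewrite (Ts_ge0 (conj Bb b0)) //; by have /andP[] := T_itv b0.
  by move: y0; rewrite /y mr scale0r addr0; apply/eqP; exact: push_neq0A.
- split; first by rewrite /loop; contauto.
  have /andP[T1' T3] := T1; have [_ [Bb b0]] := Dx; have [Ab _] := Bb.
  have t2 : -1 <= Ts x.2 - 2 <= 1 by apply/andP; split; lra.
  split; first exact: loop_B.
  apply: loop_neq0 => // /(Ts8 (conj Bb b0)); rewrite ger0_norm; lra.
- split; first by rewrite /push /sg /nu; contauto.
  case: x Dx {cT} T1 => t b /= [/= t01 [Bb b0]] T1; have [Ab pb] := Bb.
  (* [Ts b >= 3] occurs only on the positive side, where [p b] is a positive multiple of [r]; so
     pushing along [r] is safe even with [p b] restored. *)
  have rb : 0 < rho b.
    rewrite ltNge; apply/negP => rb; move: T1; rewrite (Ts_le0 (conj Bb b0) rb).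
    by have /andP[] := T_itv b0; lra.
  have TE := Ts_ge0 (conj Bb b0) (ltW rb).
  have Zb : nonzero Z b by split => //; right.
  have [Yy y0] := G_Y (DG_T Zb) (etrans (congr1 (<=%R 3) (esym TE)) T1).
  rewrite -TE in Yy y0; split; first exact: push_r_Y.
  have sgi := sg_itv T1; have /andP[sg0 sg1] := sgi.
  have sg1' : 0 <= 1 - sg (Ts b) by rewrite subr_ge0.
  set y := q b + nu (Ts b) *: p b in Yy y0 *.
  apply: (push_neq0 (a := (1 - sg (Ts b)) *: q b + sg (Ts b) *: e)
    (k := (1 - sg (Ts b)) * (nu (Ts b) * rho b) + sg (Ts b) * (1 - sg (Ts b)) * `|e - y|)) => //.
  + exact: A_cone.
  + by rewrite addr_ge0 ?mulr_ge0 // ?(ltW rb) // /nu le_max lexx.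
  + rewrite -regroup /push; congr (_ *: _ + _ + _).
    by rewrite /y [in LHS]pb scalerA.
- have := Ts_rho x.2; rewrite T1 mul1r => rb.
  rewrite [Num.max 1 0]max_l // push1 loop1; last first.
    by rewrite distrC (_ : 2 - 1 = 1) ?normr1 //; lra.
  by rewrite max_r ?scale0r ?addr0 ?pushe // oppr_le0.
- rewrite loop1; last by rewrite (_ : 3 - 2 = 1) ?normr1 //; lra.
  by rewrite /sg (_ : 4 - 3 = 1) ?max_r ?push1 ?pushe //; lra.
Qed.

Let H2_cont : {within h_dom, continuous H2}.
Proof.
have t11 t : `|clamp11 t| <= 1 by rewrite ler_norml clamp11_itv.
apply: inW_cont => x Dx; have cT := Ts_cont2 Dx.
  by rewrite /loop /clamp11; contauto.
have [/andP[t0 t1] [Bb b0]] := Dx; have [Ab _] := Bb.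
split; first exact: loop_B.
apply: loop_neq0 => //.
(* Now [q b = 0], so [Ts] is 8 or -8; a shift by at most 2 leaves it outside the clamping range, and
   the loop is at [e]. *)
move=> /(Ts8 (conj Bb b0)) => T8'.
have [Tp|Tn] := leP 0 (Ts x.2).
  by rewrite clamp11_ge ?normr1 //; rewrite ger0_norm // in T8'; lra.
by rewrite clamp11_le ?normrN1 //; rewrite ltr0_norm // in T8'; lra.
Qed.

Let mix y s t k m :
  (1 - t) *: ((1 - s) *: y + s *: e + k *: r) + t *: (y + m *: r) =
  ((1 - t) * (1 - s) + t) *: y + ((1 - t) * s) *: e + ((1 - t) * k + t * m) *: r.
Proof.
rewrite !scalerDr !scalerA !scalerDl.
by rewrite addrACA; congr (_ + _); rewrite addrAC.
Qed.

Let H3_cont : {within h_dom, continuous H3}.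
Proof.
apply: inW_cont => x Dx; have cT := Ts_cont2 Dx.
  by rewrite /loop /clamp11; contauto.
case: x Dx {cT} => t b /= [/= /andP[t0 t1] [Bb b0]]; have [Ab pb] := Bb.
set s := clamp11 (Ts b); have s11 : -1 <= s <= 1 by exact: clamp11_itv.
have s1' : 0 <= 1 - `|s| by rewrite subr_ge0 ler_norml.
have t1' : 0 <= 1 - t by rewrite subr_ge0.
pose k := s * (1 - `|s|) * `|e - q b|.
pose a := ((1 - t) * (1 - `|s|) + t) *: q b + ((1 - t) * `|s|) *: e.
have Aa : A a by apply: A_cone; rewrite ?addr_ge0 ?mulr_ge0.
have E : (1 - t) *: loop (q b) s + t *: b = a + ((1 - t) * k + t * rho b) *: r.
  by rewrite {2}(BE Bb); exact: mix.
have Bx : B ((1 - t) *: loop (q b) s + t *: b) by rewrite E; exact: B_intro.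
split => //; apply/eqP => x0.
have c0 : (1 - t) * k + t * rho b = 0.
  have := rhoE ((1 - t) * k + t * rho b) (AL Aa); rewrite -E x0 => <-.
  by apply: rhoL; exact: AL.
(* Both ends of the segment lie on the same side of [L], so multiplying [c0] by [rho b] yields a
   vanishing sum of two nonnegative terms. Hence [t = 0] or [rho b = 0], and in the second case the
   segment is constant at [b]. *)
have srho : 0 <= s * rho b.
  have Tr := Ts_rho b; have [r0'|r0'] := leP 0 (rho b).
    rewrite mulr_ge0 // /s /clamp11 le_max le_min ler01 (Ts_ge0 (conj Bb b0)) //.
    by have /andP[-> _] := T_itv b0; rewrite /= orbT.
  rewrite mulr_le0 ?(ltW r0') // /s /clamp11 ge_max lerN10 ge_min.
  rewrite (Ts_le0 (conj Bb b0)) ?(ltW r0') // oppr_le0.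
  by have /andP[-> _] := T_itv b0; rewrite /= orbT.
have kr : 0 <= k * rho b.
  rewrite /k [X in 0 <= X](_ : _ = s * rho b * ((1 - `|s|) * `|e - q b|)); last by ring.
  by apply: mulr_ge0 => //; exact: mulr_ge0.
have kr2 : 0 <= (1 - t) * (k * rho b) by rewrite mulr_ge0.
have : t * rho b ^+ 2 = 0.
  have : (1 - t) * (k * rho b) + t * rho b ^+ 2 = 0.
    by rewrite -[RHS](mulr0 (rho b)) -c0; ring.
  have tr : 0 <= t * rho b ^+ 2 by rewrite mulr_ge0 ?sqr_ge0.
  by move/eqP; rewrite paddr_eq0 // => /andP[_ /eqP].
move=> /eqP; rewrite mulf_eq0 sqrf_eq0 => /orP[] /eqP z0.
  move: x0; rewrite z0 subr0 scale0r addr0 scale1r; apply/eqP/loop_neq0 => //.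
  move=> qb; have := Ts8 (conj Bb b0) qb; rewrite /s.
  have [Tp|Tn] := leP 0 (Ts b).
    by rewrite ger0_norm // => T8'; rewrite clamp11_ge ?normr1 //; lra.
  by rewrite ltr0_norm // => T8'; rewrite clamp11_le ?normrN1 //; lra.
have s0 : s = 0 by rewrite /s /Ts z0 !mul0r mulr0 clamp11_id // lerN10 ler01.
have qb : b = q b by rewrite {1}(BE Bb) z0 scale0r addr0.
move: x0; rewrite s0 loop_ge0 // push0 -qb -scalerDl subrK scale1r => b0'.
by rewrite b0' eqxx in b0.
Qed.

Let gf_B : ptd_homotopic R (summand_pt iB)
  ((g \o f) \o wedge_lift summand_pt (i := iB)) (wedge_lift summand_pt (i := iB)).
Proof.
have lift_e : wedge_lift summand_pt (summand_pt iB) = w0.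
  by rewrite -inW_lift inW_base.
have val_e : set_val (summand_pt iB) = e by [].
have Ts_e : Ts e = 0 by rewrite /Ts (rhoL Le) !mul0r mulr0.
pose k1 (x : set_type (summand iB)) := H1 (1, set_val x).
pose k2 (x : set_type (summand iB)) := H2 (1, set_val x).
apply: (ptd_homotopic_trans (g := k1)); last first.
  apply: (ptd_homotopic_trans (g := k2)).
    apply: (ptd_homotopic_within H2_cont) => [x|//|t t01]; last first.
      by rewrite /H2 /k1 /H1 val_e /= qe pe scaler0 addr0 Ts_e loope inW_base /glue ler01 push1 inW_base.
    have [Bb b0] : nonzero B (set_val x) by exact: set_valP.
    rewrite /H2 /k1 /H1 /= !push1 subr0 mulr1 /glue.
    have [T1|T1] := leP (Ts (set_val x)) 1.
      by rewrite clamp11_le ?loop1 ?normrN1 ?inW_base //; lra.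
    have [T3|T3] := leP (Ts (set_val x)) 3.
      by rewrite clamp11_id //; apply/andP; split; lra.
    by rewrite clamp11_ge ?loop1 ?normr1 ?inW_base //; lra.
  apply: (ptd_homotopic_within H3_cont) => [x|x|t t01].
  - by rewrite /H3 /k2 /H2 /= subr0 subrr mulr0 subr0 scale1r scale0r addr0.
  - by rewrite /H3 /= subrr scale0r scale1r add0r inW_lift.
  - rewrite /H3 /k2 /H2 val_e /= qe !loope.
    by rewrite -scalerDl subrK scale1r.
apply: (ptd_homotopic_within H1_cont) => [x|//|t t01]; last first.
  rewrite /H1 val_e /= qe pe scaler0 addr0 Ts_e /glue ler01 maxxx push0 (rhoL Le).
  by rewrite oppr0 maxxx scale0r addr0 pushe inW_base gfE fvec_e G_e.
rewrite /= gfE fvecB; set b := set_val x.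
have Bb : nonzero B b by exact: set_valP.
have [[Ab pb] b0] := Bb; have [s0|s0] := leP 0 (rho b).
  rewrite Phi_ge0 ?(proj1 Bb) // /H1 /= !push0 (Ts_ge0 Bb s0).
  have /andP[T0' _] := T_itv b0.
  by rewrite max_l // max_r ?oppr_le0 // scale0r addr0.
have s0' := ltW s0.
(* On the negative side [Phi b] lies in [L], where [G] is the inclusion, and [Ts b <= 0] selects the
   first branch of [glue]. *)
rewrite Phi_le0 // /H1 /= !push0 (Ts_le0 Bb s0') max_r; last first.
  by rewrite oppr_le0; have /andP[] := T_itv b0.
rewrite push0 max_l ?oppr_ge0 // G_0; last first.
  by rewrite -[q b]scale1r; apply: L_lin => //; exact: AL.
rewrite /glue ifT //; have /andP[T0' _] := T_itv b0; lra.
Qed.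

Hypothesis hausV : hausdorff_space V.

Lemma splitting : ptd_equiv R total_pt (wedge_lift summand_pt (summand_pt ord0)).
Proof.
exists g, f; split; first by split; [exact: g_cont|exact: f_cont].
- by rewrite /g -[set_val total_pt]/e G_e.
- by rewrite -/w0 -(inW_base iL) f_inW ?fvec_e ?(clipK total_pt total_pt) //; exact: summand_base.
- exact: fg_homotopic.
- apply: ptd_homotopic_wedge => i.
    apply: accessible_closed_set1; apply: hausdorff_accessible.
    exact: hausdorff_set_type.
  have [->|->|->] : [\/ i = iL, i = iB | i = iY].
    by case: i => -[|[|[|//]]] ?; [constructor 1|constructor 2|constructor 3]; exact: val_inj.
  + exact: gf_L.
  + exact: gf_B.
  + exact: gf_Y.
Qed.

End Splitting.

(** * Cones and spheres *)

Lemma cont_matrix (T U : topologicalType) m n (f : T -> 'M[U]_(m, n)) x :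
  (forall i j, continuous_at x (fun y => f y i j)) -> continuous_at x f.
Proof.
move=> cf A [P Pn PA].
have fP : \forall y \near x, forall ij : 'I_m * 'I_n, P ij.1 ij.2 (f y ij.1 ij.2).
  by apply: filter_forall => -[i j]; exact: cf (Pn i j).
by apply: filterS fP => y fP; apply: PA => i j; exact: (fP (i, j)).
Qed.

Lemma cont_sum (R : realType) (T : topologicalType) (V : normedModType R)
    (I : finType) (f : I -> T -> V) x :
  (forall i, continuous_at x (f i)) ->
  continuous_at x (fun y => \sum_i f i y).
Proof.
move=> cf; elim: (index_enum I) => [|i s IH].
  rewrite (_ : (fun y => _) = fun=> 0); first exact: cont_cst.
  by apply/funext => y; rewrite big_nil.
rewrite (_ : (fun y => _) = fun y => f i y + \sum_(j <- s) f j y).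
  exact: cont_add.
by apply/funext => y; rewrite big_cons.
Qed.

Section Radial.
Variables (R : realType) (N : nat).
Implicit Types (z : 'rV[R]_N) (C : set 'rV[R]_N).

(** The Euclidean norm: the norm on row vectors is the maximum norm, while the spheres are given by
    sums of squares. *)
Definition norm2 z : R := Num.sqrt (\sum_i z 0 i ^+ 2).

Definition unit_part C : set 'rV[R]_N := [set z | C z /\ \sum_i z 0 i ^+ 2 = 1].

Lemma norm2_gt0 z : z != 0 -> 0 < norm2 z.
Proof.
move=> z0; rewrite sqrtr_gt0 lt_def sumr_ge0 ?andbT => [|i _]; last exact: sqr_ge0.
apply: contra z0; rewrite psumr_eq0 => [/allP z0|i _]; last exact: sqr_ge0.
apply/eqP/rowP => i; rewrite mxE; apply/eqP; rewrite -sqrf_eq0.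
by apply: z0; rewrite mem_index_enum.
Qed.

Lemma sum_sqr z : \sum_i z 0 i ^+ 2 = norm2 z ^+ 2.
Proof. by rewrite sqr_sqrtr // sumr_ge0 // => i _; exact: sqr_ge0. Qed.

Lemma norm2_continuous : continuous norm2.
Proof.
move=> z; apply: (cont_comp (h := @Num.sqrt R)).
  exact: sqrt_continuous.
apply: cont_sum => i.
have ci : continuous (fun y : 'rV[R]_N => y 0 i) by exact: coord_continuous.
have -> : (fun y : 'rV[R]_N => y 0 i ^+ 2) = (fun y => y 0 i * y 0 i).
  by apply/funext => y; rewrite expr2.
by contauto.
Qed.

Lemma unit_part_neq0 C z : unit_part C z -> nonzero C z.
Proof.
move=> [Cz z1]; split => //; apply/eqP => z0; move: z1; rewrite z0 big1.
  by move/eqP; rewrite eq_sym oner_eq0.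
by move=> i _; rewrite mxE expr0n.
Qed.

Variables (C : set 'rV[R]_N) (e : 'rV[R]_N).
Hypothesis C_scale : forall z s, 0 < s -> C z -> C (s *: z).
Variable Ce : unit_part C e.

Let e_nonzero : set_type (nonzero C) := set_pt (unit_part_neq0 Ce).
Let e_unit : set_type (unit_part C) := set_pt Ce.

(** The deformation multiplies each vector by a positive factor moving from the inverse of its norm
    to 1; [C] absorbs it, and [e], of norm 1, stays put. *)
Lemma ptd_equiv_radial : ptd_equiv R e_nonzero e_unit.
Proof.
pose F (x : set_type (nonzero C)) : set_type (unit_part C) :=
  clip e_unit ((norm2 (set_val x))^-1 *: set_val x).
pose G (x : set_type (unit_part C)) : set_type (nonzero C) :=
  clip e_nonzero (set_val x).
have GE x : set_val (G x) = set_val x.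
  by rewrite /G val_clip //; apply: unit_part_neq0; exact: set_valP.
have normalize z : nonzero C z -> unit_part C ((norm2 z)^-1 *: z).
  move=> [Cz /norm2_gt0 z0]; split; first by apply: C_scale => //; rewrite invr_gt0.
  under eq_bigr do rewrite mxE exprMn.
  by rewrite -mulr_sumr sum_sqr -exprMn mulVf ?expr1n // gt_eqF.
have FE x : set_val (F x) = (norm2 (set_val x))^-1 *: set_val x.
  by rewrite /F val_clip //; apply: normalize; exact: set_valP.
have norm1 z : unit_part C z -> norm2 z = 1 by move=> [_ z1]; rewrite /norm2 z1 sqrtr1.
have cn := norm2_continuous.
have ci (z : 'rV[R]_N) : z != 0 -> continuous_at z (fun y => (norm2 y)^-1).
  by move=> /norm2_gt0 z0; apply: cont_inv; rewrite ?gt_eqF //; exact: cn.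
exists F, G; split.
- split.
    apply: (continuous_compW (D := nonzero C) (h := set_val)
      (phi := fun z => clip e_unit ((norm2 z)^-1 *: z))).
    + apply: (continuous_clip (a := e_unit) _ normalize).
      apply: within_continuous_at => z [_ z0]; have := ci z z0; move=> cz.
      by contauto.
    + by move=> x; exact: set_valP.
    + exact: continuous_val.
  apply: (continuous_compW (D := unit_part C) (h := set_val)
    (phi := fun z => clip e_nonzero z)).
  + apply: (continuous_clip (a := e_nonzero) _ (@unit_part_neq0 C)).
    by apply: within_continuous_at => z _; contauto.
  + by move=> x; exact: set_valP.
  + exact: continuous_val.
- by apply: val_inj; rewrite -!set_valE FE /= (norm1 e) // invr1 scale1r.
- by apply: val_inj; rewrite -!set_valE GE.
- apply: (ptd_homotopic_within (H := fun x : R * 'rV[R]_N => clip e_nonzero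
     (((1 - x.1) * (norm2 x.2)^-1 + x.1) *: x.2))) => [|x|x|t _].
  + apply: continuous_clip.
      apply: within_continuous_at => x [_ [_ x0]].
      have cx : continuous_at x (fun y => (norm2 y.2)^-1).
        by apply: continuous_comp (ci _ x0); exact: cvg_snd.
      by contauto.
    move=> -[t z] /= [/andP[t0 t1] [Cz z0]].
    have c0 : 0 < (1 - t) * (norm2 z)^-1 + t.
      have [->|t00] := eqVneq t 0.
        by rewrite subr0 mul1r addr0 invr_gt0 norm2_gt0.
      have n0 : 0 < (norm2 z)^-1 by rewrite invr_gt0 norm2_gt0.
      rewrite ltr_wpDl //; last by rewrite lt_def t00.
      by rewrite mulr_ge0 ?subr_ge0 // ltW.
    by split; [exact: C_scale|rewrite scaler_eq0 negb_or gt_eqF].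
  + by apply: val_inj; rewrite -!set_valE /= GE FE subr0 mul1r addr0 val_clip //;
      apply: unit_part_neq0; apply: normalize; exact: set_valP.
  + by rewrite subrr mul0r add0r scale1r clipK.
  + apply: val_inj; rewrite -!set_valE /= GE FE /= (norm1 e) // invr1 mulr1 subrK.
    by rewrite scale1r val_clip //; exact: unit_part_neq0.
- rewrite (_ : F \o G = id); first by apply: ptd_homotopic_refl => x; exact: cvg_id.
  apply/funext => x /=; apply: val_inj; rewrite -!set_valE FE GE norm1.
    by rewrite invr1 scale1r.
  exact: set_valP.
Qed.

End Radial.

Section Bouquet.
Variable R : realType.

Let sphere m : topologicalType := set_type (unit_sphere R m).
Let base m : sphere m := unit_sphere_base R m.

(** Only the multiset of dimensions is recorded and the index type is left open, so that a wedge of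
    bouquets amounts to concatenating lists. *)
Definition bouquet (X : topologicalType) (x : X) (s : seq nat) :=
  exists (I : finType) (i0 : I) (d : I -> nat),
    perm_eq [seq d i | i <- enum I] s /\
    ptd_equiv R x (wedge_lift (fun i => base (d i)) (base (d i0))).

Lemma bouquet_equiv (X Y : topologicalType) (x : X) (y : Y) s :
  ptd_equiv R x y -> bouquet y s -> bouquet x s.
Proof.
move=> xy [I [i0 [d [ds yd]]]]; exists I, i0, d; split => //.
exact: ptd_equiv_trans xy yd.
Qed.

Lemma hausdorff_sphere m : hausdorff_space (sphere m).
Proof. by apply: hausdorff_set_type; exact: norm_hausdorff. Qed.

Lemma bouquet_sphere m : bouquet (base m) [:: m].
Proof.
exists 'I_1, ord0, (fun=> m); split; first by rewrite enum_ordSl /= enum_ord0.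
pose b := fun i : 'I_1 => base m; rewrite -/b -/(b ord0).
have cl : continuous (wedge_lift b (i := ord0)) by exact: (@wedge_lift_continuous _ _ b ord0).
pose k (w : wedge b) : sphere m := wedge_fun (fun (i : 'I_1) (a : sphere m) => a) w.
have kE i a : k (wedge_lift b (i := i) a) = a by rewrite /k wedge_lift_funE.
have ck : continuous k by apply: wedge_fun_continuous => // i a; exact: cvg_id.
apply: (@ptd_equiv_homeo R _ _ _ _ (wedge_lift b (i := ord0)) k cl ck) => [a|w|//].
  exact: kE.
by have [i [a ->]] := wedge_surj w; rewrite kE (ord1 i).
Qed.

Lemma bouquet_wedge (I : finType) (X : I -> topologicalType)
    (x : forall i, X i) (i0 : I) (s : I -> seq nat) :
  (forall i, closed [set x i]) -> (forall i, bouquet (x i) (s i)) ->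
  bouquet (wedge_lift x (x i0)) (flatten [seq s i | i <- enum I]).
Proof.
move=> clx /(_ _)/cid Hs; pose J i := sval (Hs i).
have Hj i := cid (svalP (Hs i)); pose j0 i : J i := sval (Hj i).
have Hd i := cid (svalP (Hj i)); pose d i : J i -> nat := sval (Hd i).
have dE i : perm_eq [seq d i j | j <- enum (J i)] (s i) := proj1 (svalP (Hd i)).
have xE i : ptd_equiv R (x i) (wedge_lift (fun j => base (d i j)) (base (d i (j0 i))))
  := proj2 (svalP (Hd i)).
have cly i : closed [set wedge_lift (fun j => base (d i j)) (base (d i (j0 i)))].
  apply: accessible_closed_set1; apply: hausdorff_accessible.
  by apply: wedge_hausdorff => j; exact: hausdorff_sphere.
apply: bouquet_equiv (ptd_equiv_wedge i0 clx cly xE) _.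
exists {i & J i}, (Tagged J (j0 i0)), (fun p => d (tag p) (tagged p)); split.
  rewrite enumT [in X in perm_eq X _]unlock /= /tag_enum map_flatten -map_comp.
  rewrite -enumT; elim: (enum I) => //= i e IH; apply: perm_cat => //.
  by rewrite -map_comp -enumT; exact: dE.
exact: (ptd_equiv_wedge_flatten R (fun i j => base (d i j)) j0 i0 (Tagged J (j0 i0))).
Qed.

End Bouquet.

Section Cones.
Variables (R : realType) (N : nat).
Implicit Types (S : {set 'I_N}) (l : seq ('I_N * 'I_N)).

(** Subspaces are given by supports inside one fixed space, so that the induction reaches smaller
    cones without changing the ambient type. *)
Definition coord_space S : set 'rV[R]_N := [set z | forall j, j \notin S -> z 0 j = 0].

Definition pair_cone S l : set 'rV[R]_N :=
  [set z | coord_space S z /\ exists2 ab, ab \in l & z 0 ab.1 = 0 /\ z 0 ab.2 = 0].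

Lemma sum_delta (o : 'I_N) : \sum_i (delta_mx 0 o : 'rV[R]_N) 0 i ^+ 2 = 1.
Proof.
rewrite (bigD1 o) //= mxE !eqxx expr1n big1 ?addr0 // => i io.
by rewrite mxE eqxx (negbTE io) expr0n.
Qed.

Lemma delta_neq0 (o : 'I_N) : (delta_mx 0 o : 'rV[R]_N) != 0.
Proof.
by apply/eqP => /rowP/(_ o); rewrite !mxE !eqxx => /eqP; rewrite oner_eq0.
Qed.

Lemma coord_space_delta S (o : 'I_N) : o \in S -> coord_space S (delta_mx 0 o).
Proof.
by move=> oS j jS; rewrite mxE eqxx /=; case: eqP jS => // ->; rewrite oS.
Qed.

Lemma bouquet_coord_space S (o : 'I_N) m
    (h : nonzero (coord_space S) (delta_mx 0 o)) :
  o \in S -> #|S| = m.+1 ->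
  bouquet R (set_pt h) [:: m].
Proof.
move=> oS cS; set e : 'rV[R]_N := delta_mx 0 o.
have eu : unit_part (coord_space S) e.
  by split; [exact: coord_space_delta|exact: sum_delta].
apply: (bouquet_equiv _ (bouquet_sphere R m)).
have := ptd_equiv_radial _ eu; rewrite (Prop_irrelevance (unit_part_neq0 _) h).
move=> rad; apply: ptd_equiv_trans (rad _) _.
  by move=> z s _ Sz j jS; rewrite mxE Sz // mulr0.
(* Coordinate [o] comes first because the base point of the model sphere is the first unit
   vector. *)
pose s := o :: enum (S :\ o).
have ss : size s = m.+1.
  by rewrite /= -cardE; have := cardsD1 o S; rewrite oS cS add1n => -[->].
have us : uniq s by rewrite /= enum_uniq mem_enum !inE eqxx.
have Ss j : (j \in s) = (j \in S).
  by rewrite inE mem_enum !inE; case: eqP => // ->; rewrite oS.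
pose f (z : 'rV[R]_N) : 'rV[R]_m.+1 := \row_i z 0 (nth o s i).
pose g (v : 'rV[R]_m.+1) : 'rV[R]_N :=
  \row_j (if j \in S then v 0 (inord (index j s)) else 0).
have cf : continuous f.
  move=> z; apply: cont_matrix => i j.
  rewrite (_ : (fun y => f y i j) = fun y => y 0 (nth o s j)).
    exact: coord_continuous.
  by apply/funext => y; rewrite mxE.
have cg : continuous g.
  move=> z; apply: cont_matrix => i j; case jS : (j \in S).
    rewrite (_ : (fun y => g y i j) = fun y => y 0 (inord (index j s))).
      exact: coord_continuous.
    by apply/funext => y; rewrite mxE jS.
  rewrite (_ : (fun y => g y i j) = fun=> 0); first exact: cont_cst.
  by apply/funext => y; rewrite mxE jS.
have sums (z : 'rV[R]_N) : coord_space S z ->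
    \sum_j z 0 j ^+ 2 = \sum_(i < m.+1) z 0 (nth o s i) ^+ 2.
  move=> Sz; rewrite (bigID [in S]) /= addrC big1 ?add0r => [|j jS]; last first.
    by rewrite Sz // expr0n.
  transitivity (\sum_(j <- s) z 0 j ^+ 2).
    by rewrite big_uniq //=; apply: eq_bigl => j; rewrite Ss.
  by rewrite (big_nth o) ss big_mkord.
have fg v : f (g v) = v.
  apply/rowP => i; rewrite !mxE -Ss mem_nth ?ss // index_uniq ?ss //.
  by rewrite inord_val.
have gS v : coord_space S (g v) by move=> j /negbTE jS; rewrite mxE jS.
have gf z : coord_space S z -> g (f z) = z.
  move=> Sz; apply/rowP => j; rewrite !mxE; case: ifPn => jS; last by rewrite Sz.
  have js : (index j s < m.+1)%N by rewrite -ss index_mem Ss.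
  by rewrite inordK // nth_index // Ss.
have fU z : unit_part (coord_space S) z -> unit_sphere R m (f z).
  move=> [Sz z1]; rewrite /unit_sphere /= -z1 (sums _ Sz).
  by apply: eq_bigr => i _; rewrite mxE.
have gU v : unit_sphere R m v -> unit_part (coord_space S) (g v).
  move=> v1; split => //; rewrite (sums _ (gS v)) -[RHS]v1.
  by apply: eq_bigr => i _; rewrite -{2}(fg v) [in RHS]mxE.
pose e' : set_type (unit_part (coord_space S)) := set_pt eu.
apply: (@ptd_equiv_homeo _ _ _ _ _
  (fun x : set_type (unit_part (coord_space S)) =>
     clip (unit_sphere_base R m) (f (set_val x)))
  (fun x : set_type (unit_sphere R m) => clip e' (g (set_val x)))).
- apply: (continuous_compW (D := unit_part (coord_space S)) (h := set_val)
    (phi := fun x => clip (unit_sphere_base R m) (f x))).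
  + by apply: continuous_clip fU; exact: continuous_subspaceT.
  + by move=> x; exact: set_valP.
  + exact: continuous_val.
- apply: (continuous_compW (D := unit_sphere R m) (h := set_val)
    (phi := fun x => clip e' (g x))).
  + by apply: continuous_clip gU; exact: continuous_subspaceT.
  + by move=> x; exact: set_valP.
  + exact: continuous_val.
- move=> x; have [Sx x1] := set_valP x.
  by rewrite val_clip ?gf ?clipK //; apply: fU; split.
- by move=> x; rewrite val_clip ?fg ?clipK //; apply: gU; exact: set_valP.
- apply: val_inj; rewrite -!set_valE val_clip; last exact: fU.
  apply/rowP => i; rewrite [LHS]mxE [LHS]mxE [RHS]mxE !eqxx; congr (_%:R).
  by rewrite -[X in _ == X]/(nth o s 0) nth_uniq ?ss.
Qed.

End Cones.

Arguments coord_space R {N} S _.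
Arguments pair_cone R {N} S l _.

Section PairCones.
Variables (R : realType) (N : nat).
Implicit Types (S : {set 'I_N}) (l : seq ('I_N * 'I_N)) (z : 'rV[R]_N).

Lemma coord_space_lin S a b x y :
  coord_space R S x -> coord_space R S y -> coord_space R S (a *: x + b *: y).
Proof. by move=> Sx Sy j jS; rewrite !mxE Sx // Sy // !mulr0 addr0. Qed.

Definition pairs_in S (o : 'I_N) l :=
  all (fun cd => [&& cd.1 \in S :\ o & cd.2 \in S :\ o]) l.

Lemma pair_cone_base S (o : 'I_N) l :
  o \in S -> pairs_in S o l -> l != [::] ->
  nonzero (pair_cone R S l) (delta_mx 0 o).
Proof.
move=> oS; case: l => //= cd l /andP[/andP[]]; rewrite !inE => /andP[co _] /andP[do' _].
move=> _ _; split; last exact: delta_neq0.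
split; first exact: coord_space_delta.
by exists cd; rewrite ?mem_head // !mxE eqxx (negbTE co) (negbTE do').
Qed.

Lemma bouquet_transport (C C' : set 'rV[R]_N) e (h : C e) (h' : C' e) s :
  C = C' -> bouquet R (set_pt h) s -> bouquet R (set_pt h') s.
Proof. by move=> CC'; subst C'; rewrite (Prop_irrelevance h h'). Qed.

Lemma bouquet_pair_cone_cons S (o a b : 'I_N) l sL sB sY
    (hL : nonzero (coord_space R (S :\ a :\ b)) (delta_mx 0 o))
    (hB : nonzero (pair_cone R (S :\ b) l) (delta_mx 0 o))
    (hY : nonzero (pair_cone R S l) (delta_mx 0 o))
    (h : nonzero (pair_cone R S ((a, b) :: l)) (delta_mx 0 o)) :
  a \in S -> b \in S -> o \in S -> a != b -> a != o -> b != o ->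
  l != [::] -> pairs_in (S :\ a :\ b) o l ->
  bouquet R (set_pt hL) sL -> bouquet R (set_pt hB) sB ->
  bouquet R (set_pt hY) sY -> bouquet R (set_pt h) (sL ++ sB ++ sY).
Proof.
move=> aS bS oS ab ao bo l0 lS bL bB bY.
set S' := S :\ a :\ b in hL bL lS *.
pose d : 'rV[R]_N := \row_j ((j == a) || (j == b))%:R.
pose p : {linear 'rV[R]_N -> 'rV[R]_N} := mulmxr (diag_mx d).
have pE z j : p z 0 j = if (j == a) || (j == b) then z 0 j else 0.
  by rewrite /= mul_mx_diag !mxE; case: ifP => _; rewrite ?mulr1 ?mulr0.
have qE z j : (z - p z) 0 j = if (j == a) || (j == b) then 0 else z 0 j.
  by rewrite mxE [(- p z) 0 j]mxE pE; case: ifP => _; rewrite ?subrr ?subr0.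
pose u : 'rV[R]_N := \row_j (j \in S')%:R.
have S'ab j : ((j == a) || (j == b)) = false -> (j \in S') = (j \in S).
  by move=> /norP[ja jb]; rewrite !inE ja jb.
have p_cont : continuous p.
  move=> z; apply: cont_matrix => i j.
  rewrite [X in continuous_at _ X](_ : _ = fun y : 'rV[R]_N => y 0 j * d 0 j); last first.
    by apply/funext => y; rewrite (ord1 i) /= mul_mx_diag mxE.
  have cj : continuous (fun y : 'rV[R]_N => y 0 j) by exact: coord_continuous.
  by contauto.
have rho_cont : continuous (fun z : 'rV[R]_N => z 0 a) by exact: coord_continuous.
have pK z : p (p z) = p z.
  by apply/rowP => j; rewrite !pE; case: (_ || _).
have pr : p (delta_mx 0 a) = delta_mx 0 a.
  apply/rowP => j; rewrite pE !mxE eqxx /=.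
  by case: (j == a) => //=; rewrite if_same.
have Lp z : coord_space R S' z -> p z = 0.
  move=> Lz; apply/rowP => j; rewrite pE mxE; case: ifP => // jab.
  by rewrite Lz // !inE; case/orP: jab => /eqP ->; rewrite eqxx ?andbF.
have rhoE z s : coord_space R S' z -> (z + s *: delta_mx 0 a) 0 a = s.
  by move=> Lz; rewrite !mxE !eqxx mulr1 Lz ?add0r // !inE eqxx andbF.
have Le : coord_space R S' (delta_mx 0 o).
  by apply: coord_space_delta; rewrite !inE oS eq_sym bo eq_sym ao.
have Lu : coord_space R S' u by move=> j /negbTE jS; rewrite mxE jS.
have AL : pair_cone R S' l `<=` coord_space R S' by move=> z [].
have A0 : pair_cone R S' l 0.
  split; first by move=> j _; rewrite mxE.
  by case: l l0 {lS hB hY h bB bY AL} => // cd l _; exists cd; rewrite ?mem_head // !mxE.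
have lS1 cd : cd \in l -> [/\ cd.1 \in S', cd.1 != o & cd.2 != o].
  by move=> /(allP lS)/andP[]; rewrite !(in_setD1 _ S') => /andP[-> ->] /andP[->].
have A_cone (z : 'rV[R]_N) (s t : R) : pair_cone R S' l z -> 0 <= s -> 0 <= t ->
    pair_cone R S' l (s *: z + t *: delta_mx 0 o).
  move=> [Lz [cd cdl [c0 d0]]] _ _; split; first exact: coord_space_lin.
  have [_ /negbTE co /negbTE do'] := lS1 _ cdl.
  by exists cd => //; rewrite !mxE c0 d0 eqxx co do' !mulr0 addr0.
(* [z] vanishes at the coordinate [cd.1], where [u] is 1, so that coordinate of the sum is [s]. *)
have Au (z : 'rV[R]_N) (s : R) : pair_cone R S' l z -> 0 <= s ->
    z + s *: u = 0 -> s = 0.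
  move=> [_ [cd cdl [c0 _]]] _ /rowP/(_ cd.1).
  by have [cS' _ _] := lS1 _ cdl; rewrite !mxE c0 cS' mulr1 add0r.
(* The pairs of [l] avoid [a] and [b], so deleting these two coordinates affects none of their
   conditions. *)
have qcone z : pair_cone R S' l (z - p z) <-> pair_cone R S l z.
  split=> [[Sz [cd cdl zcd]]|[Sz [cd cdl [c0 d0]]]].
    split.
      move=> j jS; have := Sz j; rewrite qE; case: ifP => [|jab].
        by case/orP => /eqP jE; move: jS; rewrite jE ?aS ?bS.
      by apply; rewrite S'ab.
    exists cd => //.
    have := allP lS _ cdl; rewrite !inE -!andbA => /and5P[_ cb ca _ /and4P[_ db da _]].
    by move: zcd; rewrite !qE (negbTE cb) (negbTE ca) (negbTE db) (negbTE da).
  split; last by exists cd => //; rewrite !qE c0 d0 !if_same.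
  move=> j; rewrite qE; case: ifP => // jab; rewrite S'ab //; exact: Sz.
(* For [p z], being a multiple of the unit vector of [a] means that coordinate [b] vanishes: K' x R
   is a cone of the same kind on [S :\ b]. *)
have Bcone z : (pair_cone R S' l (z - p z) /\ p z = z 0 a *: delta_mx 0 a) <->
    pair_cone R (S :\ b) l z.
  have zb : p z = z 0 a *: delta_mx 0 a <-> z 0 b = 0.
    split=> [/rowP/(_ b)|zb]; first by rewrite pE !mxE eqxx orbT eq_sym (negbTE ab) mulr0.
    apply/rowP => j; rewrite pE !mxE eqxx /=; have [->|ja] := eqVneq j a.
      by rewrite mulr1.
    by rewrite mulr0 /=; case: eqP => // ->.
  rewrite qcone zb; split=> [[[Sz lz] zb0]|[Sz lz]].
    split => // j; rewrite !inE negb_and negbK => /orP[/eqP -> //|].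
    exact: Sz.
  split; last by apply: Sz; rewrite !inE eqxx.
  by split => // j jS; apply: Sz; rewrite !inE (negbTE jS) andbF.
have := @splitting R _ p (fun z => z 0 a) (delta_mx 0 o) u (delta_mx 0 a)
  (coord_space R S') (pair_cone R S' l) p_cont rho_cont pK pr (delta_neq0 _ _)
  (@coord_space_lin S') Lp rhoE Le (delta_neq0 _ _) Lu AL A0 A_cone Au
  (@norm_hausdorff _ _).
set tp := total_pt _ _ _ _ => eqv.
have Zcone : nonzero [set z | coord_space R S' z \/ pair_cone R S' l (z - p z)] =
    nonzero (pair_cone R S ((a, b) :: l)).
  congr nonzero; apply/seteqP; split=> z /=.
    case=> [Lz|/qcone[Sz [cd cdl zcd]]]; last first.
      by split => //; exists cd => //; rewrite inE cdl orbT.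
    split; last by exists (a, b); rewrite ?mem_head //= !Lz // !inE eqxx ?andbF.
    by move=> j /negbTE jS; apply: Lz; rewrite !inE jS !andbF.
  move=> [Sz [cd + zcd]]; rewrite inE => /orP[/eqP cE|cdl]; last first.
    by right; apply/qcone; split => //; exists cd.
  left => j; rewrite !inE !negb_and !negbK => /or3P[/eqP ->|/eqP ->|]; last exact: Sz.
    by move: zcd; rewrite cE => -[].
  by move: zcd; rewrite cE => -[].
suff : bouquet R tp (sL ++ sB ++ sY) by exact: bouquet_transport Zcone.
apply: bouquet_equiv eqv _.
pose s (i : 'I_3) := nth [::] [:: sL; sB; sY] i.
have -> : sL ++ sB ++ sY = flatten [seq s i | i <- enum 'I_3].
  by rewrite !enum_ordSl enum_ord0 /= /s /= cats0.
apply: bouquet_wedge => i.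
  apply: accessible_closed_set1; apply: hausdorff_accessible.
  by apply: hausdorff_set_type; exact: norm_hausdorff.
case: i => -[|[|[|//]]] lt3.
- exact: bouquet_transport bL.
- apply: bouquet_transport bB.
  by congr nonzero; apply/seteqP; split=> z /Bcone.
- apply: bouquet_transport bY.
  by congr nonzero; apply/seteqP; split=> z /qcone.
Qed.

End PairCones.

(** * Induction on the number of pairs *)

(** [q] is the ambient dimension and [t] the number of pairs. L has dimension q - 2, hence a unit
    sphere of dimension q - 3; K' x R and K' x R^2 are cones with one pair less in dimensions q - 1
    and q. *)
Fixpoint sphere_dims (q t : nat) : seq nat :=
  if t is t'.+1 then (q - 3)%N :: sphere_dims (q - 1) t' ++ sphere_dims q t'
  else [::].

Lemma count_sphere_dims v q t : count_mem v (sphere_dims q t) =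
  (\sum_(i < t) 'C(t, i.+1) * (q - 3 - i == v))%N.
Proof.
elim: t q => [|t IH] q; first by rewrite big_ord0.
rewrite /= count_cat !IH.
(* The sum over ['C(t, i)] starts with the single sphere of L and continues, shifted by one, as the
   count for q - 1; the sum over ['C(t, i.+1)] is the count for q. *)
under [RHS]eq_bigr do rewrite binS mulnDl.
rewrite big_split /= [in RHS]addnC big_ord_recl big_ord_recr /= bin0 mul1n subn0.
rewrite (bin_small (ltnSn t)) mul0n addn0 -!addnA; congr (_ + (_ + _))%N.
apply: eq_bigr => i _; congr (_ * (_ == _))%N.
by rewrite /bump /=; lia.
Qed.

Lemma perm_sphere_dims n t : perm_eq
  [seq (2 * n - 1 - (tag j).+1)%N | j : {i : 'I_t & 'I_('C(t, i.+1))}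
     <- enum {: {i : 'I_t & 'I_('C(t, i.+1))}}]
  (sphere_dims (2 * n + 1) t).
Proof.
apply/allP => v _ /=; apply/eqP; rewrite count_sphere_dims.
rewrite enumT unlock /= /tag_enum map_flatten -map_comp count_flatten -map_comp.
rewrite sumnE big_map -enumT big_enum /=; apply: eq_bigr => i _.
rewrite -map_comp -enumT count_map.
rewrite (eq_count (a2 := fun=> 2 * n + 1 - 3 - i == v)%N); last first.
  by move=> j /=; congr (_ == _); lia.
by case: (_ == v); rewrite ?count_predT ?size_enum_ord ?muln1 // count_pred0 muln0.
Qed.

Definition pair_coords N (l : seq ('I_N * 'I_N)) : seq 'I_N :=
  flatten [seq [:: cd.1; cd.2] | cd <- l].

Lemma pair_coords_mem N (l : seq ('I_N * 'I_N)) cd : cd \in l ->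
  (cd.1 \in pair_coords l) /\ (cd.2 \in pair_coords l).
Proof.
by move=> cdl; split; apply/flatten_mapP; exists cd; rewrite // !inE eqxx ?orbT.
Qed.

(** [S] varies in the induction on [l]: the two smaller cones live on [S :\ b] and on [S], which
    both still contain [o] and the remaining pairs. *)
Lemma bouquet_pair_cone (R : realType) N (S : {set 'I_N}) (o : 'I_N) l
    (h : nonzero (pair_cone R S l) (delta_mx 0 o)) :
  l != [::] -> uniq (o :: pair_coords l) -> {subset o :: pair_coords l <= S} ->
  bouquet R (set_pt h) (sphere_dims #|S| (size l)).
Proof.
elim: l S h => // -[a b] l IH S h _.
have -> : pair_coords ((a, b) :: l) = [:: a, b & pair_coords l] by [].
rewrite !cons_uniq !inE !negb_or => /andP[/and3P[oa ob ol] /andP[/andP[ab al] /andP[bl ul]]] lS.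
have oS : o \in S by apply: lS; rewrite inE eqxx.
have aS : a \in S by apply: lS; rewrite !inE eqxx orbT.
have bS : b \in S by apply: lS; rewrite !inE eqxx !orbT.
have lS' j : j \in pair_coords l -> j \in S by move=> jl; apply: lS; rewrite !inE jl !orbT.
set S' := S :\ a :\ b.
have oS' : o \in S' by rewrite !inE ob oa oS.
have cS : #|S| = (#|S'| + 2)%N.
  have ba : b \in S :\ a by rewrite !inE eq_sym ab.
  by rewrite (cardsD1 a S) aS (cardsD1 b (S :\ a)) ba addnA addnC.
have cS'0 : (0 < #|S'|)%N by apply/card_gt0P; exists o.
have bL (hL : nonzero (coord_space R S') (delta_mx 0 o)) :
    bouquet R (set_pt hL) [:: (#|S| - 3)%N].
  by apply: (bouquet_coord_space hL oS'); rewrite cS (subnDr 2 _ 1) subn1 prednK.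
have hL : nonzero (coord_space R S') (delta_mx 0 o).
  by split; [exact: coord_space_delta|exact: delta_neq0].
(* With a single pair, K' is empty and lacks even 0, so the splitting does not apply; the cone is
   then the linear space L. *)
have [l0|l0] := eqVneq l [::].
  subst l; apply: bouquet_transport (bL hL); congr nonzero.
  apply/seteqP; split=> z /=.
    move=> Lz; split; last by exists (a, b); rewrite ?mem_head //= !Lz // !inE eqxx ?andbF.
    by move=> j /negbTE jS; apply: Lz; rewrite !inE jS !andbF.
  move=> [Sz [cd + zcd]]; rewrite inE => /eqP cE.
  move=> j; rewrite !inE !negb_and !negbK => /or3P[/eqP ->|/eqP ->|]; last exact: Sz.
    by move: zcd; rewrite cE => -[].
  by move: zcd; rewrite cE => -[].
have pl (P : {set 'I_N}) : (forall j, j \in pair_coords l -> j != a -> j != b -> j != o -> j \in P) ->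
    pairs_in P o l.
  move=> HP; apply/allP => cd /pair_coords_mem[cl dl]; rewrite !inE.
  have ne j (j' : 'I_N) : j \in pair_coords l -> j' \notin pair_coords l -> j != j'.
    by move=> jl; apply: contra => /eqP <-.
  by rewrite !HP ?ne.
have hB : nonzero (pair_cone R (S :\ b) l) (delta_mx 0 o).
  apply: pair_cone_base => //; first by rewrite !inE ob.
  by apply: pl => j jl ja jb jo; rewrite !inE jb lS'.
have hY : nonzero (pair_cone R S l) (delta_mx 0 o).
  by apply: pair_cone_base => //; apply: pl => j jl _ _ _; rewrite lS'.
have -> : sphere_dims #|S| (size ((a, b) :: l)) =
    [:: (#|S| - 3)%N] ++ sphere_dims #|S :\ b| (size l) ++ sphere_dims #|S| (size l).
  by rewrite /= (_ : #|S :\ b| = #|S| - 1)%N // [in RHS](cardsD1 b S) bS add1n subn1.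
apply: (bouquet_pair_cone_cons (hL := hL) (hB := hB) (hY := hY)) => //; try by rewrite eq_sym.
- by apply: pl => j jl ja jb jo; rewrite !inE jb ja lS'.
- apply: IH => //; first by rewrite /= ol.
  move=> j; rewrite inE => /predU1P[->|jl]; rewrite !inE ?ob //.
  by rewrite lS' // andbT; apply: contra bl => /eqP <-.
- apply: IH => //; first by rewrite /= ol.
  by move=> j; rewrite inE => /predU1P[->//|jl]; rewrite lS'.
Qed.

(** * The strata of the even sphere *)

Section ComplexTopology.
Variable R : realType.

Lemma ball_complexE (z w : R[i]^o) (r : R) :
  ball z (r%:C)%C w = (Normc.normc (z - w) < r) :> Prop.
Proof. by rewrite /ball /= /ball_ /= -ltcR. Qed.

Lemma Re_continuous : continuous (fun z : R[i]^o => complex.Re z).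
Proof.
move=> z U /nbhs_ballP[r /= r0 rU]; apply/nbhs_ballP.
exists (r%:C)%C; first by rewrite /= ltcR.
move=> w; rewrite ball_complexE => zw; apply: rU; rewrite /ball /=.
apply: le_lt_trans zw; case: z => a b; case: w => c d /=.
by rewrite -sqrtr_sqr ler_sqrt ?addr_ge0 ?sqr_ge0 // lerDl sqr_ge0.
Qed.

Lemma Im_continuous : continuous (fun z : R[i]^o => complex.Im z).
Proof.
move=> z U /nbhs_ballP[r /= r0 rU]; apply/nbhs_ballP.
exists (r%:C)%C; first by rewrite /= ltcR.
move=> w; rewrite ball_complexE => zw; apply: rU; rewrite /ball /=.
apply: le_lt_trans zw; case: z => a b; case: w => c d /=.
by rewrite -sqrtr_sqr ler_sqrt ?addr_ge0 ?sqr_ge0 // lerDr sqr_ge0.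
Qed.

Lemma cont_complex (T : topologicalType) (f g : T -> R) x :
  continuous_at x f -> continuous_at x g ->
  continuous_at x (fun y => (f y +i* g y)%C : R[i]^o).
Proof.
move=> cf cg U /nbhs_ballP[r /= r0 rU].
(* Radii of balls in [R[i]] are complex numbers; a positive one is real. *)
have rE : r = ((complex.Re r)%:C)%C by case: r r0 {rU} => a b; rewrite ltcE /= => /andP[/eqP -> _].
rewrite rE in r0 rU; rewrite ltcR in r0; move: (complex.Re r) r0 rU => {rE}r r0 rU.
have r2 : 0 < r / 2 by rewrite divr_gt0.
have Uf : nbhs x [set y | `|f x - f y| < r / 2] by exact: cf _ (nbhsx_ballx (f x) _ r2).
have Ug : nbhs x [set y | `|g x - g y| < r / 2] by exact: cg _ (nbhsx_ballx (g x) _ r2).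
apply: filterS2 Uf Ug => y /= yf yg; apply: rU; rewrite ball_complexE.
apply: (@le_lt_trans _ _ (`|f x - f y| + `|g x - g y|)); last by lra.
rewrite -[leRHS]ger0_norm ?addr_ge0 // -sqrtr_sqr ler_sqrt ?sqr_ge0 //.
by rewrite [(`|_| + `|_|) ^+ 2]sqrrD !real_normK ?num_real // lerD2r lerDl mulrn_wge0 // mulr_ge0.
Qed.

End ComplexTopology.

Section Strata.
Variables (R : realType) (n k : nat).
Hypotheses (k_ge1 : (1 <= k)%N) (k_le_n : (k <= n)%N).

(** The face of [A] contains the edge of index i exactly when i is not in [A], and a vertex contains
    no edge. *)
Lemma V_setP (q : 'rV[R]_n * R) : V_set k q <->
  orbit_space q /\ exists2 j : 'I_n, (k <= j.+1)%N & q.1 0 j = 0.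
Proof.
have kn : (k.-1 < n)%N by rewrite prednK.
split=> [[F [Fface Fedge] Fq]|[Qq [j kj qj]]].
  case: Fface => [[A _ FA]|F1|F1]; last 2 first.
  - rewrite F1 in Fq; rewrite Fq /=; split.
      split; last by move=> i; rewrite mxE.
      by rewrite big1 ?expr1n ?add0r // => i _; rewrite mxE expr0n.
    by exists (Ordinal kn); rewrite ?mxE //= prednK.
  - rewrite F1 in Fq; rewrite Fq /=; split.
      split; last by move=> i; rewrite mxE.
      by rewrite sqrrN big1 ?expr1n ?add0r // => i _; rewrite mxE expr0n.
    by exists (Ordinal kn); rewrite ?mxE //= prednK.
  rewrite FA in Fq Fedge; have [Qq qA] := Fq; split => //.
  apply: contrapT => nq; apply: Fedge => i ki q' [Qq' q'i]; split => // j jA.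
  apply: q'i; apply: contra_notN nq => /eqP ji.
  by exists i => //; apply: qA; rewrite -ji.
(* The midpoint of the edge, where coordinate [j] is 1: it witnesses that the edge leaves the
   face. *)
pose ej : 'rV[R]_n * R := (delta_mx 0 j, 0).
have Eej : edge j ej.
  split; last by move=> i ij; rewrite mxE (negbTE ij) andbF.
  split; last by move=> i; rewrite mxE ler0n.
  rewrite expr0n addr0 (bigD1 j) //= mxE !eqxx expr1n big1 ?addr0 // => i ij.
  by rewrite mxE (negbTE ij) andbF expr0n.
have [n1|n1] := ltnP 1 n.
  exists (coord_face [set j]%SET); last by split => // i; rewrite inE => /eqP ->.
  split; first by constructor 1; exists [set j]%SET; rewrite ?cards1.
  move=> /(_ j kj ej Eej)[_ /(_ j)]; rewrite inE eqxx => /(_ isT) /eqP.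
  by rewrite mxE !eqxx oner_eq0.
(* For [n = 1] the bound [#|A| < n] rules out the face cut out by coordinate [j]; the point is then
   one of the two vertices. *)
have q10 : q.1 = 0.
  apply/rowP => i; rewrite mxE -qj; congr (q.1 0 _); apply: val_inj => /=.
  by move: (ltn_ord i) (ltn_ord j); lia.
have q21 : q.2 ^+ 2 = 1.
  case: Qq => + _; rewrite q10 big1 ?add0r // => i _.
  by rewrite mxE expr0n.
have vertex (x : R) : ~ (forall i : 'I_n, (k <= i.+1)%N -> edge i `<=` [set (0, x)]).
  move=> /(_ j kj ej Eej)/(congr1 fst)/rowP/(_ j)/eqP.
  by rewrite !mxE !eqxx oner_eq0.
move: q21 => /eqP; rewrite sqrf_eq1 => /orP[]/eqP q2.
  by exists [set (0, 1)]; [split; [constructor 2|]|rewrite /= -q10 -q2; case: q {Qq qj q10 q2}].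
by exists [set (0, -1)]; [split; [constructor 3|]|rewrite /= -q10 -q2; case: q {Qq qj q10 q2}].
Qed.

Lemma U_setP (p : 'rV[R[i]^o]_n * R) : U_set R n k p <->
  even_sphere p /\ exists2 j : 'I_n, (k <= j.+1)%N & p.1 0 j = 0.
Proof.
rewrite /U_set /=; split=> [[Sp /V_setP[_ [j kj pj]]]|[Sp [j kj pj]]].
  split => //; exists j => //; move: pj; rewrite mxE.
  exact: Normc.eq0_normc.
split => //; apply/V_setP; split; last first.
  by exists j => //; rewrite mxE pj Normc.normc0.
split; last by move=> i; rewrite mxE; case: (p.1 0 i) => a b; exact: sqrtr_ge0.
by rewrite -[RHS]Sp; congr (_ + _); apply: eq_bigr => i _; rewrite mxE.
Qed.

(** The real coordinate comes first, then the real parts, then the imaginary parts. The first one,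
    [o], lies in no pair and carries the base point. *)
Let N := (1 + (n + n))%N.
Let o : 'I_N := lshift (n + n) ord0.
Let re (j : 'I_n) : 'I_N := rshift 1 (lshift n j).
Let im (j : 'I_n) : 'I_N := rshift 1 (rshift n j).

Definition strata_pairs : seq ('I_N * 'I_N) :=
  [seq (re j, im j) | j : 'I_n <- enum 'I_n & (k <= j.+1)%N].

Let to_real (p : 'rV[R[i]^o]_n * R) : 'rV[R]_N :=
  row_mx (const_mx p.2)
    (row_mx (\row_j complex.Re (p.1 0 j)) (\row_j complex.Im (p.1 0 j))).

Let of_real (z : 'rV[R]_N) : 'rV[R[i]^o]_n * R :=
  (\row_j (z 0 (re j) +i* z 0 (im j))%C, z 0 o).

Let to_realE p : (to_real p 0 o = p.2) *
  (forall j, to_real p 0 (re j) = complex.Re (p.1 0 j)) *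
  (forall j, to_real p 0 (im j) = complex.Im (p.1 0 j)).
Proof.
by rewrite /to_real; split=> [|j]; first split=> [|j]; rewrite ?row_mxEl ?row_mxEr
  ?row_mxEl ?row_mxEr !mxE.
Qed.

Let idx (i : 'I_N) : [\/ i = o, exists j, i = re j | exists j, i = im j].
Proof.
rewrite -(fintype.splitK i); case: (fintype.split i) => [i'|i'] /=.
  by constructor 1; rewrite (ord1 i').
rewrite -(fintype.splitK i'); case: (fintype.split i') => j /=; first by constructor 2; exists j.
by constructor 3; exists j.
Qed.

Let of_realK z : to_real (of_real z) = z.
Proof.
apply/rowP => i; case: (idx i) => [->|[j ->]|[j ->]]; rewrite to_realE /= ?mxE //.
Qed.

Let to_realK p : of_real (to_real p) = p.
Proof.
case: p => z x; rewrite /of_real !to_realE; congr pair.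
by apply/rowP => j; rewrite mxE !to_realE /=; case: (z 0 j).
Qed.

Let to_real_continuous : continuous to_real.
Proof.
move=> p; apply: cont_matrix => i' i; rewrite (ord1 i').
have cz j : continuous_at p (fun q : 'rV[R[i]^o]_n * R => q.1 0 j).
  apply: (cont_comp (h := fun z : 'rV[R[i]^o]_n => z 0 j)); last exact: cvg_fst.
  exact: coord_continuous.
case: (idx i) => [->|[j ->]|[j ->]].
- rewrite [X in continuous_at _ X](_ : _ = fun q : 'rV[R[i]^o]_n * R => q.2); first by contauto.
  by apply/funext => q; rewrite to_realE.
- rewrite [X in continuous_at _ X](_ : _ = fun q : 'rV[R[i]^o]_n * R => complex.Re (q.1 0 j)).
    exact: (cont_comp (@Re_continuous R)).
  by apply/funext => q; rewrite to_realE.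
- rewrite [X in continuous_at _ X](_ : _ = fun q : 'rV[R[i]^o]_n * R => complex.Im (q.1 0 j)).
    exact: (cont_comp (@Im_continuous R)).
  by apply/funext => q; rewrite to_realE.
Qed.

Let of_real_continuous : continuous of_real.
Proof.
have cc i : continuous (fun z : 'rV[R]_N => z 0 i) by exact: coord_continuous.
move=> z; apply: cont_pair; last exact: cc.
apply: cont_matrix => i j.
rewrite [X in continuous_at _ X](_ : _ =
  fun z : 'rV[R]_N => (z 0 (re j) +i* z 0 (im j))%C : R[i]^o); last first.
  by apply/funext => y; rewrite mxE.
by apply: cont_complex; exact: cc.
Qed.

Let sum_to_real p : \sum_i to_real p 0 i ^+ 2 =
  \sum_(i < n) Normc.normc (p.1 0 i) ^+ 2 + p.2 ^+ 2.
Proof.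
rewrite big_split_ord /= big_ord1 -[lshift _ _]/o to_realE addrC; congr (_ + _).
rewrite big_split_ord /= -big_split /=; apply: eq_bigr => j _.
rewrite -[rshift 1 _]/(re j) -[rshift 1 (rshift _ _)]/(im j) !to_realE.
by case: (p.1 0 j) => a b /=; rewrite sqr_sqrtr // addr_ge0 ?sqr_ge0.
Qed.

Lemma strata_cone p : U_set R n k p <->
  unit_part (pair_cone R [set: 'I_N]%SET strata_pairs) (to_real p).
Proof.
rewrite U_setP /even_sphere /unit_part /= sum_to_real.
have Sp : coord_space R [set: 'I_N]%SET (to_real p) by move=> j; rewrite inE.
split=> [[p1 [j kj pj]]|[[_ [cd + [c0 d0]]] p1]].
  split => //; split => //; exists (re j, im j).
    by apply/mapP; exists j; rewrite // mem_filter kj mem_enum.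
  by rewrite /= !to_realE pj.
move=> /mapP[j]; rewrite mem_filter => /andP[kj _] cE; split => //; exists j => //.
by move: c0 d0; rewrite cE /= !to_realE; case: (p.1 0 j) => a b /= -> ->.
Qed.

Lemma uniq_strata_coords : uniq (o :: pair_coords strata_pairs).
Proof.
rewrite /strata_pairs /pair_coords -map_comp.
have : uniq [seq j : 'I_n <- enum 'I_n | (k <= j.+1)%N] by rewrite filter_uniq ?enum_uniq.
elim: [seq _ <- _ | _] => //= j s IH /andP[js us].
have /andP[os us'] := IH us.
have memP (i : 'I_N) : i \in flatten [seq [:: (re x, im x).1; (re x, im x).2] | x <- s] ->
    exists2 j', j' \in s & i = re j' \/ i = im j'.
  by move=> /flatten_mapP[j' j's]; rewrite !inE => /orP[]/eqP ->; exists j'; auto.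
have jn := ltn_ord j.
rewrite us' andbT !inE !negb_or os andbT -!andbA; apply/and4P; split.
- by [].
- by rewrite -(inj_eq val_inj) /=; lia.
- apply/negP => /memP[j' j's [] /(congr1 val) /=].
    by rewrite !add1n => -[/val_inj jj']; rewrite jj' j's in js.
  by have := ltn_ord j'; lia.
- apply/negP => /memP[j' j's [] /(congr1 val) /=].
    by have := ltn_ord j'; lia.
  by rewrite !add1n => -[/addnI/val_inj jj']; rewrite jj' j's in js.
Qed.

Lemma size_strata_pairs : size strata_pairs = (n + 1 - k)%N.
Proof.
rewrite size_map size_filter -(count_map val (fun i => k <= i.+1)%N) val_enum_ord.
elim: n => [|m IH]; first by move: k_ge1; rewrite /=; lia.
rewrite -{1}addn1 iotaD count_cat IH /= addn0 add0n.
by move: k_ge1; case: leqP; lia.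
Qed.

Lemma U_set_bouquet (t : nat) : t = (n + 1 - k)%N ->
  exists x : set_type (U_set R n k), bouquet R x (sphere_dims (2 * n + 1) t).
Proof.
move=> tE; set C := pair_cone R [set: 'I_N]%SET strata_pairs.
have sz := size_strata_pairs; have uq := uniq_strata_coords.
have t0 : strata_pairs != [::] by rewrite -size_eq0 sz; lia.
have NE : sphere_dims N t = sphere_dims (2 * n + 1) t by congr sphere_dims; rewrite /N; lia.
have bc (h : nonzero C (delta_mx 0 o)) : bouquet R (set_pt h) (sphere_dims (2 * n + 1) t).
  rewrite -NE; have := bouquet_pair_cone h t0 uq (fun j _ => finset.in_setT j).
  by rewrite cardsT card_ord sz -tE.
have Ce : unit_part C (delta_mx 0 o).
  split; last exact: sum_delta.
  split; first by move=> j; rewrite inE.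
  case: strata_pairs t0 uq => // -[a b] l _; rewrite /= !inE !negb_or => /andP[/and3P[oa ob _] _].
  by exists (a, b); rewrite ?mem_head // !mxE eqxx !(eq_sym _ o) (negbTE oa) (negbTE ob).
have Ux : U_set R n k (of_real (delta_mx 0 o)) by apply/strata_cone; rewrite of_realK.
exists (set_pt Ux); apply: bouquet_equiv (bc (unit_part_neq0 Ce)).
apply: (@ptd_equiv_trans _ _ _ _ (set_pt Ce)); last first.
  apply: ptd_equiv_sym; apply: ptd_equiv_radial.
  move=> z s _ [Sz [cd cdl [c0 d0]]]; split; first by move=> j; rewrite inE.
  by exists cd => //; rewrite !mxE c0 d0 mulr0.
have toC p : U_set R n k p -> unit_part C (to_real p) by move=> /strata_cone.
have ofU z : unit_part C z -> U_set R n k (of_real z).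
  by move=> Cz; apply/strata_cone; rewrite of_realK.
apply: (@ptd_equiv_homeo _ _ _ _ _
  (fun x : set_type (U_set R n k) => clip (set_pt Ce) (to_real (set_val x)))
  (fun x : set_type (unit_part C) => clip (set_pt Ux) (of_real (set_val x)))).
- apply: (continuous_compW (D := U_set R n k) (h := set_val)
    (phi := fun x => clip (set_pt Ce) (to_real x))).
  + by apply: continuous_clip toC; exact: continuous_subspaceT.
  + by move=> x; exact: set_valP.
  + exact: continuous_val.
- apply: (continuous_compW (D := unit_part C) (h := set_val)
    (phi := fun x => clip (set_pt Ux) (of_real x))).
  + by apply: continuous_clip ofU; exact: continuous_subspaceT.
  + by move=> x; exact: set_valP.
  + exact: continuous_val.
- by move=> x; rewrite val_clip ?to_realK ?clipK //; apply: toC; exact: set_valP.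
- by move=> x; rewrite val_clip ?of_realK ?clipK //; apply: ofU; exact: set_valP.
- by apply: val_inj; rewrite -!set_valE val_clip ?of_realK //; apply: toC.
Qed.

End Strata.

Theorem lemma3p4 (R : realType) (n k t : nat)
    (k_ge1 : (1 <= k)%N) (k_le_n : (k <= n)%N) (t_def : t = (n + 1 - k)%N) :
  homotopy_equivalent R (set_type (U_set R n k))
    (sphere_wedge R {i : 'I_t & 'I_('C(t, i.+1))}
       (fun j => (2 * n - 1 - (tag j).+1)%N)).
Proof.
have [x [I [i0 [d [dE xd]]]]] := U_set_bouquet R k_ge1 k_le_n t_def.
have /perm_eq_bij[h h_bij dh] : perm_eq [seq d i | i <- enum I]
    [seq (2 * n - 1 - (tag j).+1)%N | j : {i : 'I_t & 'I_('C(t, i.+1))}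
      <- enum {: {i : 'I_t & 'I_('C(t, i.+1))}}].
  by apply: perm_trans dE _; rewrite perm_sym; exact: perm_sphere_dims.
apply: ptd_equiv_homotopy_equivalent; apply: ptd_equiv_trans xd _.
exact: (ptd_equiv_wedge_reindex R (unit_sphere_base R) i0 (h i0) h_bij dh).
Qed.
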